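(* Let $\mathcal{P}_0$ be a nonempty convex and weakly compact set of probability measures on $(\mathbb{R},\mathcal{B}(\mathbb{R}))$, let $\mathcal{P}$ be the set of probability measures on $(\mathbb{R}^{\mathbb{N}},\mathcal{B}(\mathbb{R}^{\mathbb{N}}))$ constructed from $\mathcal{P}_0$ as in the context, and let $\{X_i\}_{i\in\mathbb{N}}$ be the canonical (i.i.d. under $\mathcal{P}$) sequence. Let $-\infty<\underline{\mu}\le\overline{\mu}<+\infty$. Then $$\lim_{n\to\infty}\mathbb{E}^{\mathcal{P}}\left[\varphi\left(\frac{\sum_{i=1}^nX_i}{n}\right)\right]=\max_{\underline{\mu}\le\mu\le\overline{\mu}}\varphi(\mu)\qquad\text{for all }\varphi\in C_b(\mathbb{R})$$ if and only if the following three conditions hold: (i) $\lim_{n\to\infty} n\,V(|X_1|\ge n)=0$; (ii) $\lim_{n\to\infty}\mathbb{E}^{\mathcal{P}}[(-n\vee X_1)\wedge n]=\overline{\mu}$; (iii) $\lim_{n\to\infty}-\mathbb{E}^{\mathcal{P}}[(-n\vee (-X_1))\wedge n]=\underline{\mu}$.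
   Context: $\mathbb{N}=\{1,2,\dots\}$; $a\vee b=\max(a,b)$, $a\wedge b=\min(a,b)$; $C_b(\mathbb{R})$ is the space of bounded continuous real functions on $\mathbb{R}$. ''Weakly compact'' refers to the topology of weak convergence of probability measures (tested against bounded continuous functions). Canonical space: $(\mathbb{R}^{\mathbb{N}},\mathcal{B}(\mathbb{R}^{\mathbb{N}}))$ with canonical random variables $X_i(\omega)=\omega_i$ for $\omega=(\omega_1,\omega_2,\dots)\in\mathbb{R}^{\mathbb{N}}$. Construction of $\mathcal{P}$ from $\mathcal{P}_0$: $\mathcal{P}$ is the set of all probability measures $P$ on $(\mathbb{R}^{\mathbb{N}},\mathcal{B}(\mathbb{R}^{\mathbb{N}}))$ for which there exist $\mu_1\in\mathcal{P}_0$ and, for each $i\ge2$, a probability kernel $\kappa_i$ from $\mathbb{R}^{i-1}$ to $\mathbb{R}$ (i.e. $\kappa_i(x_1,\dots,x_{i-1},\cdot)$ is a probability measure on $(\mathbb{R},\mathcal{B}(\mathbb{R}))$ for every $(x_1,\dots,x_{i-1})\in\mathbb{R}^{i-1}$, and $\kappa_i(\cdot,B)$ is $\mathcal{B}(\mathbb{R}^{i-1})$-measurable for every $B\in\mathcal{B}(\mathbb{R})$) with $\kappa_i(x_1,\dots,x_{i-1},\cdot)\in\mathcal{P}_0$ for all $(x_1,\dots,x_{i-1})$, such that for all $n\ge1$ and all $A\in\mathcal{B}(\mathbb{R}^n)$, $$P(\{\omega:(\omega_1,\dots,\omega_n)\in A\})=\int_{\mathbb{R}}\mu_1(dx_1)\int_{\mathbb{R}}\kappa_2(x_1,dx_2)\cdots\int_{\mathbb{R}}\mathbf{1}_A(x_1,\dots,x_n)\,\kappa_n(x_1,\dots,x_{n-1},dx_n).$$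 The sequence $\{X_i\}$ is then called a canonical i.i.d. sequence under $\mathcal{P}$ (this is terminology, meaning exactly that $\mathcal{P}$ is constructed in this way with the same set $\mathcal{P}_0$ at every step). Sublinear expectation and capacity: $\mathbb{E}^{\mathcal{P}}[X]=\sup_{P\in\mathcal{P}}E_P[X]$ for measurable $X$; $V(A)=\sup_{P\in\mathcal{P}}P(A)$ for $A\in\mathcal{B}(\mathbb{R}^{\mathbb{N}})$. *)

(* Defs.v *)
From HB Require Import structures.
From mathcomp Require Import all_boot all_order all_algebra.
From mathcomp Require Import all_classical all_reals all_analysis.
From mathcomp Require Import measurable_realfun.

Set Implicit Arguments.
Unset Strict Implicit.
Unset Printing Implicit Defensive.

Import Order.TTheory GRing.Theory Num.Theory.
Import numFieldNormedType.Exports.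

Local Open Scope classical_set_scope.
Local Open Scope ring_scope.

Definition Cb (R : realType) (phi : R -> R) : Prop :=
  continuous phi /\ bounded_fun phi.

(* The coarsest topology on the probability measures on the line that makes
   P |-> \int phi dP continuous for every phi in C_b. *)
Definition weak_conv_topology (R : realType) :=
  initial_topology
    (fun (P : probability R R) =>
       (fun phi : {phi : R -> R | Cb phi} => \int[P]_x sval phi x)%R
       : {ptws {phi : R -> R | Cb phi} -> R}).

Definition weakly_compact (R : realType) (P0 : set (probability R R)) : Prop :=
  compact (P0 : set (weak_conv_topology R)).

(* A [probability] is a function on all sets, but only its values on measurable
   sets are meaningful; hence a mixture of P and Q is identified by its values
   on the measurable sets. *)
Definition convex_probs (R : realType) (P0 : set (probability R R)) : Prop :=
  forall (P Q : probability R R) (t : R), P0 P -> P0 Q -> 0 <= t <= 1 ->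
  exists2 S : probability R R, P0 S &
    forall A : set R, measurable A ->
      S A = (t%:E * P A + (1 - t)%:E * Q A)%E.

(* R^N with the Borel sigma-algebra of the product topology. *)
Definition RN (R : realType) := g_sigma_algebraType (@open {ptws nat -> R}).

(* Coordinates are numbered from 0: [canon_rv i] is X_(i+1). *)
Definition canon_rv (R : realType) (i : nat) (w : RN R) : R := w i.

(* [kappa n] is the kernel from R^(n+1) to R giving the law of [canon_rv n.+1]
   conditionally on the coordinates 0, ..., n. *)
Definition kernel_seq (R : realType) := forall n, n.+1.-tuple R -> probability R R.

Definition kernel_in (R : realType) (P0 : set (probability R R)) (n : nat)
    (k : n.-tuple R -> probability R R) : Prop :=
  (forall B : set R, measurable B ->
     measurable_fun [set: n.-tuple R] (fun x => k x B)) /\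
  (forall x, P0 (k x)).

(* \int mu1(dx_0) \int kappa_0(x_0, dx_1) ...
     \int g(x_0, ..., x_n) kappa_(n-1)(x_0, ..., x_(n-1), dx_n) *)
Fixpoint iter_int (R : realType) (mu1 : probability R R) (kappa : kernel_seq R)
    (n : nat) : (n.+1.-tuple R -> \bar R) -> \bar R :=
  match n with
  | 0 => fun g => (\int[mu1]_x g [tuple x])%E
  | m.+1 => fun g =>
      iter_int mu1 kappa
        (fun x : m.+1.-tuple R => (\int[kappa m x]_y g (rcons_tuple x y))%E)
  end.

Definition iid_probs (R : realType) (P0 : set (probability R R)) :
    set (probability (RN R) R) :=
  [set P : probability (RN R) R | exists mu1 (kappa : kernel_seq R),
    [/\ P0 mu1,
        forall n, kernel_in P0 (kappa n) &
        forall n (A : set (n.+1.-tuple R)), measurable A ->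
          P [set w | A [tuple canon_rv i w | i < n.+1]] =
          iter_int mu1 kappa (fun x => (\1_A x)%:E)]].

Definition sublin_exp d (T : measurableType d) (R : realType)
    (PP : set (probability T R)) (X : T -> R) : \bar R :=
  ereal_sup [set 'E_P[X] | P in PP]%E.

Definition upper_cap d (T : measurableType d) (R : realType)
    (PP : set (probability T R)) (A : set T) : \bar R :=
  ereal_sup [set P A | P in PP].

Definition is_maximum (R : realType) (A : set R) (m : R) : Prop :=
  A m /\ ubound A m.

(* Main.v *)
Require Import Defs.
From HB Require Import structures.
From mathcomp Require Import all_boot all_order all_algebra.
From mathcomp Require Import all_classical all_reals all_analysis.
From mathcomp Require Import measurable_realfun.
From mathcomp Require Import ring lra.

Set Implicit Arguments.
Unset Strict Implicit.
Unset Printing Implicit Defensive.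

Import Order.TTheory GRing.Theory Num.Theory.
Import numFieldNormedType.Exports.

Local Open Scope classical_set_scope.
Local Open Scope ring_scope.

(** The proof reduces everything to uniform estimates for sums under a law of
the family.

Sufficiency. Truncate the terms at level [n]. Vanishing tails make truncation
improbable ([big_jump_tail]) and make the second moment of the truncated terms
negligible with respect to [n] ([clip_sqr_le]). A one-sided Chebyshev inequality
then follows without independence: conditionally on the past, each term has a
law of the given set, whose truncated mean is at most [muhi] up to a small
error, so that the square of the positive part of the centred sum grows on
average by at most a second moment at each step ([psum_growth], [psum_tail]).
Hence the mean lies close to [[mulo, muhi]] with high probability, uniformly
over the family ([unif_tail]), and the expectations of [phi] are asymptotically
at most its maximum. The maximum is approached by independent copies of a single
law: by convexity some law has a truncated mean close to a maximizer
([mean_attained]), and the same estimate, applied to the set made of this law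
only, is the weak law of large numbers.

Necessity. Test functions that vanish on [[mulo, muhi]] show that the mean is
uniformly concentrated there ([mean_concentrated]). Under independent copies of
one law, a term that exceeds a large multiple of [n] would throw the sum away
from where it must be at time [n], and the chance that none of [n] terms does so
decays like a geometric sequence; so [n] times the tail is small
([walk_near0_le], [ptail_le_concentrated]). With vanishing tails the uniform
weak law is available, and it identifies the limits of the extreme truncated
means ([clip_of_limit]).

Both directions need independent sequences with a given law, that is, infinite
products of probabilities. They are built by extending the content of cylinders
([cyl_content_sigma_subadditive], [iid_product_ex]). *)

(** * Borel sets of sequences *)

Lemma measurable_canon_rv (R : realType) (i : nat) :
  measurable_fun [set: RN R] (@canon_rv R i).
Proof.
apply: (measurability _ (RGenOpens.measurableE R)) => _ [_ [a [b ->] <-]].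
rewrite setTI; apply: sub_sigma_algebra.
by apply: open_comp => [x _|]; [exact: (@proj_continuous nat (fun=> R))|].
Qed.

(** An open set of the product topology only constrains finitely many
coordinates around each of its points: otherwise there would be points
outside of it converging coordinatewise to a point inside. *)
Lemma ptws_open_nbhs (R : realType) (U : set {ptws nat -> R}) (f : nat -> R) :
  open U -> U f ->
  exists n : nat, forall g : nat -> R,
    (forall i, (i < n)%N -> `|f i - g i| < n.+1%:R^-1) -> U g.
Proof.
move=> oU Uf; apply: contrapT => /forallNP H.
have {}H n : exists g : nat -> R,
    (forall i, (i < n)%N -> `|f i - g i| < n.+1%:R^-1) /\ ~ U g.
  by have /existsNP[g /not_implyP[]] := H n; exists g.
have [g gP] := choice H.
have gf : (g n : {ptws nat -> R}) @[n --> \oo] --> (f : {ptws nat -> R}).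
  apply/cvg_sup => i V [W [[A oA <-] Afi]] /=; rewrite nbhs_simpl.
  move=> AV; have : nbhs (f i) A by exact: open_nbhs_nbhs.
  move=> /nbhs_ballP[e /= e0 eA].
  near=> n; apply: AV => /=; apply: eA; rewrite /ball/=.
  have [gn _] := gP n; apply: lt_le_trans (gn i _) _; near: n.
    by exists i.+1 => // m /=.
  near do apply: ltW.
  exact: (near_infty_natSinv_lt (PosNum e0)).
have : nbhs (f : {ptws nat -> R}) U by exact: open_nbhs_nbhs.
by move=> /gf [n _ /(_ n (leqnn n))] /=; have [] := gP n.
Unshelve. all: by end_near. Qed.

(** The Borel sets of the product topology are generated by the coordinates:
by density of the rationals, an open set is a countable union of finite
intersections of preimages of rational balls. *)
Lemma measurable_fun_RN d (T : measurableType d) (R : realType)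
    (F : T -> RN R) :
  (forall i, measurable_fun [set: T] (fun t => F t i)) ->
  measurable_fun [set: T] F.
Proof.
move=> mF.
apply: (@measurability _ _ _ (RN R) _ _ (@open {ptws nat -> R})) => //.
move=> _ [U oU <-]; rewrite setTI.
pose C (nr : nat * seq rat) := [set g : RN R | forall i, (i < nr.1)%N ->
  `|ratr nr.2`_i - g i| < (2 * nr.1.+1%:R)^-1].
have -> : F @^-1` U = \bigcup_nr [set t | C nr `<=` U /\ C nr (F t)].
  apply/seteqP; split => [t /= UFt|t [nr _ [CU /CU]]//].
  have [n nU] := ptws_open_nbhs oU UFt.
  have /choice[r rP] : forall i, exists q : rat,
      `|ratr q - F t i| < (2 * n.+1%:R)^-1.
    move=> i; have e0 : 0 < (2 * n.+1%:R)^-1 :> R by rewrite invr_gt0 mulr_gt0.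
    have [q] : exists q : rat, ratr q \in
        `](F t i - (2 * n.+1%:R)^-1), (F t i + (2 * n.+1%:R)^-1)[.
      by apply: rat_in_itvoo; rewrite ltrBlDr -addrA ltrDl addr_gt0.
    by rewrite in_itv/= => qF; exists q; rewrite ltr_distl.
  exists (n, mkseq r n) => //=; split => [g Cg|i /= ni]; last first.
    by rewrite nth_mkseq.
  apply: nU => i ni; have := Cg i ni; rewrite /= nth_mkseq// => Cgi.
  rewrite (le_lt_trans (ler_distD (ratr (r i)) _ _))//.
  rewrite distrC (lt_le_trans (ltrD (rP i) Cgi))//.
  rewrite invfM; have : 0 < n.+1%:R^-1 :> R by [].
  by set y := n.+1%:R^-1; lra.
apply: countable_bigcupT_measurable; first exact: countableP.
move=> nr; have [CU|nCU] := pselect (C nr `<=` U); last first.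
  rewrite [X in measurable X](_ : _ = set0)//.
  by rewrite -subset0 => t [].
pose B i := (fun t => F t i) @^-1`
  [set x | `|ratr nr.2`_i - x| < (2 * nr.1.+1%:R)^-1].
rewrite [X in measurable X](_ : _ = \bigcap_(i < nr.1) B i).
  rewrite bigcap_mkord; apply: bigsetI_measurable => i _.
  rewrite -[X in measurable X]setTI; apply: mF => //; apply: open_measurable.
  rewrite (_ : [set _ | _] = ball (ratr nr.2`_i : R) (2 * nr.1.+1%:R)^-1)//.
  exact: ball_open.
by apply/seteqP; split => t; [move=> [_ CF]|].
Qed.

(** * Infinite products of a probability *)

Definition scons (R : realType) (xw : R * RN R) : RN R :=
  fun i => if i is j.+1 then xw.2 j else xw.1.

Lemma measurable_scons (R : realType) :
  measurable_fun [set: R * RN R] (@scons R).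
Proof.
apply: measurable_fun_RN => -[|i]; first exact: measurable_fst.
exact: (measurableT_comp (measurable_canon_rv i)).
Qed.

HB.instance Definition _ (R : realType) :=
  isMeasurableFun.Build _ _ _ _ (@scons R) (@measurable_scons R).

Definition supd (R : realType) (n : nat) (wy : RN R * R) : RN R :=
  fun i => if i == n then wy.2 else wy.1 i.

Lemma measurable_supd (R : realType) n :
  measurable_fun [set: RN R * R] (@supd R n).
Proof.
apply: measurable_fun_RN => i; rewrite /supd.
case: eqP => _; first exact: measurable_snd.
exact: (measurableT_comp (measurable_canon_rv i)).
Qed.

(** The [n]-fold product of [Q], padded with zeros so that the products of all
orders live on sequences, where they can be compared on a given cylinder. *)
Fixpoint iid_head (R : realType) (Q : probability R R) (n : nat) :
    probability (RN R) R :=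
  if n is m.+1 then
    distribution (Q \x iid_head Q m)%E (@scons R : {mfun _ >-> RN R})
  else \d_((fun=> 0) : RN R).

Definition ssection (R : realType) (x : R) (A : set (RN R)) : set (RN R) :=
  [set w | A (scons (x, w))].

Definition depends_upto (R : realType) (n : nat) (A : set (RN R)) :=
  forall w w' : nat -> R, (forall i, (i < n)%N -> w i = w' i) -> A w -> A w'.

Section iid_head.
Context (R : realType) (Q : probability R R).
Local Notation J := (iid_head Q).
Implicit Types A : set (RN R).

Lemma ssectionE x A : ssection x A = xsection (@scons R @^-1` A) x.
Proof. by rewrite xsectionE. Qed.

Lemma measurable_ssection x A : measurable A -> measurable (ssection x A).
Proof.
move=> mA; rewrite ssectionE; apply: measurable_xsection.
by rewrite -[X in measurable X]setTI; exact: measurable_scons.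
Qed.

Lemma measurable_fun_ssection n A : measurable A ->
  measurable_fun [set: R] (fun x => J n (ssection x A)).
Proof.
move=> mA; rewrite (_ : (fun x => _) = J n \o xsection (@scons R @^-1` A)).
  apply: measurable_fun_xsection.
  by rewrite -[X in measurable X]setTI; exact: measurable_scons.
by apply/funext => x/=; rewrite ssectionE.
Qed.

Lemma iid_headS n A : J n.+1 A = (\int[Q]_x J n (ssection x A))%E.
Proof. by apply: eq_integral => x _; rewrite /= ssectionE. Qed.

Lemma integral_iid_headS n (h : RN R -> \bar R) :
  measurable_fun [set: RN R] h -> (forall w, 0 <= h w)%E ->
  (\int[J n.+1]_w h w = \int[Q]_x \int[J n]_w h (scons (x, w)))%E.
Proof.
move=> mh h0; rewrite ge0_integral_distribution// fubini_tonelli1//.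
  by apply: measurableT_comp => //; exact: measurable_scons.
by move=> x /=.
Qed.

(** Although a head is extended at the front by definition, it may also be
extended at its end; the former matches sections, the latter iterated
integrals. *)
Lemma integral_iid_head_last n (h : RN R -> \bar R) :
  measurable_fun [set: RN R] h -> (forall w, 0 <= h w)%E ->
  (\int[J n.+1]_w h w = \int[J n]_w \int[Q]_y h (supd n (w, y)))%E.
Proof.
have mu m (g : RN R -> \bar R) : measurable_fun [set: RN R] g ->
    (forall w, 0 <= g w)%E ->
    measurable_fun [set: RN R] (fun w => \int[Q]_y g (supd m (w, y)))%E.
  move=> mg g0.
  apply: (measurable_fun_fubini_tonelli_F (m2 := Q) (g \o @supd R m)).
    by apply: measurableT_comp => //; exact: measurable_supd.
  by move=> wy; exact: g0.
elim: n h => [|n IH] h mh h0.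
  rewrite integral_iid_headS//= integral_dirac//; last exact: mu.
  rewrite diracT mul1e; apply: eq_integral => x _.
  rewrite integral_dirac//; last first.
    apply: (@measurableT_comp _ _ _ _ _ _ h) => //.
    exact: (measurableT_comp (@measurable_scons R)).
  rewrite diracT mul1e; congr h.
  by apply/funext => -[|i].
have mS x : measurable_fun [set: RN R] (fun w => h (scons (x, w))).
  apply: (@measurableT_comp _ _ _ _ _ _ h) => //.
  exact: (measurableT_comp (@measurable_scons R)).
rewrite integral_iid_headS// [RHS]integral_iid_headS//; last 2 first.
- exact: mu.
- by move=> w; exact: integral_ge0.
apply: eq_integral => x _; rewrite IH//.
apply: eq_integral => w _; apply: eq_integral => y _; congr h.
by apply/funext => -[|i].
Qed.

Lemma depends_upto_ssection n x A :
  depends_upto n.+1 A -> depends_upto n (ssection x A).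
Proof.
by move=> dA w w' ww'; apply: dA => -[|i] //= ni; exact: ww'.
Qed.

Lemma depends_upto_leq m n A :
  (m <= n)%N -> depends_upto m A -> depends_upto n A.
Proof.
by move=> mn dA w w' ww'; apply: dA => i im; apply: ww'; exact: leq_trans mn.
Qed.

(** Extending a head at its front turns a set into its sections, which depend
on one coordinate less. *)
Lemma iid_head_stable m n A : measurable A -> depends_upto m A -> (m <= n)%N ->
  J n A = J m A.
Proof.
elim: m n A => [|m IH] n A mA dA mn.
  have [[w Aw]|/set0P/negP/negPn/eqP ->] := pselect (A !=set0); last first.
    by rewrite !measure0.
  suff -> : A = setT by rewrite !probability_setT.
  by apply/seteqP; split => // w' _; exact: dA Aw.
case: n mn => // n; rewrite ltnS => mn.
rewrite !iid_headS; apply: eq_integral => x _.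
by apply: IH => //; [exact: measurable_ssection|exact: depends_upto_ssection].
Qed.

(** On a cylinder the sequence is eventually constant; a limit avoids choosing
the coordinates that a cylinder depends on. *)
Definition cyl_content A : \bar R := limn (fun n => J n A).

Lemma cyl_contentE n A : measurable A -> depends_upto n A ->
  cyl_content A = J n A.
Proof.
move=> mA dA; apply: lim_near_cst => //.
by exists n => // m /= nm; exact: iid_head_stable.
Qed.

End iid_head.

(** The sequences again, but measured by the algebra of cylinders only, on
which the product premeasure lives before it is extended. *)
Definition cylinderType (R : realType) := nat -> R.

Definition cylinder (R : realType) (A : set (cylinderType R)) :=
  @measurable _ (RN R) A /\ exists n, depends_upto n A.

Lemma cylinder0 (R : realType) : @cylinder R set0.
Proof. by split => //; exists 0. Qed.

Lemma cylinderU (R : realType) : setU_closed (@cylinder R).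
Proof.
move=> A B [mA [n dA]] [mB [m dB]]; split; first exact: measurableU.
exists (maxn n m) => w w' ww'.
have nm := leq_maxl n m; have mn := leq_maxr n m.
by move=> [/(depends_upto_leq nm dA ww')|/(depends_upto_leq mn dB ww')];
  [left|right].
Qed.

Lemma cylinderC (R : realType) : setC_closed (@cylinder R).
Proof.
move=> A [mA [n dA]]; split; first exact: measurableC.
exists n => w w' ww' /= nA /dA; apply: contra_not nA.
by apply => i ni; rewrite ww'.
Qed.

Definition cylinder_display : measure_display. Proof. by []. Qed.

HB.instance Definition _ (R : realType) := Pointed.on (cylinderType R).
HB.instance Definition _ (R : realType) :=
  isAlgebraOfSets.Build cylinder_display (cylinderType R)
    (@cylinder0 R) (@cylinderU R) (@cylinderC R).

Section cyl_content.
Context (R : realType) (Q : probability R R).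
Local Open Scope ereal_scope.
Local Notation J := (iid_head Q).
Local Notation nu := (cyl_content Q : set (cylinderType R) -> \bar R).
Implicit Types A : set (cylinderType R).

Lemma cyl_content_ge0 A : 0 <= nu A.
Proof.
rewrite /cyl_content; have [cJ|ncJ] := pselect (cvgn (fun n => J n A)).
  by apply: lime_ge => //; apply: nearW => n; exact: measure_ge0.
by rewrite dvgP.
Qed.

Lemma cyl_content_semi_additive : measure_function.semi_additive nu.
Proof.
move=> F n cF tF _.
have [m mP] : exists m, forall i, (i < n)%N -> depends_upto m (F i).
  elim: n => [|n [m mP]]; first by exists 0%N.
  have [_ [k dk]] := cF n; exists (maxn m k) => i; rewrite ltnS leq_eqVlt.
  move=> /predU1P[->|/mP dm]; first exact: depends_upto_leq (leq_maxr _ _) dk.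
  exact: depends_upto_leq (leq_maxl _ _) dm.
rewrite (@cyl_contentE _ _ m); last 2 first.
- by apply: bigsetU_measurable => i _; have [] := cF i.
- move=> w w' ww'; rewrite -bigcup_mkord => -[i /= ni Fiw].
  by exists i => //; exact: mP Fiw.
rewrite measure_semi_additive//; last 2 first.
- by move=> k; have [] := cF k.
- by apply: bigsetU_measurable => i _; have [] := cF i.
apply: eq_bigr => i _; rewrite (@cyl_contentE _ _ m)//; last exact: mP.
by have [] := cF i.
Qed.

HB.instance Definition _ := isContent.Build _ (cylinderType R) R nu
  cyl_content_ge0 cyl_content_semi_additive.

Lemma cylinder_ssection x A : cylinder A -> cylinder (ssection x A).
Proof.
move=> [mA [n dA]]; split; first exact: measurable_ssection.
exists n; apply: depends_upto_ssection.
exact: depends_upto_leq dA.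
Qed.

Lemma measurable_fun_cyl_content A : cylinder A ->
  measurable_fun [set: R] (fun x => nu (ssection x A)).
Proof.
move=> [mA [n dA]]; rewrite (_ : (fun x => _) = (fun x => J n (ssection x A))).
  exact: measurable_fun_ssection.
apply/funext => x; apply: cyl_contentE; first exact: measurable_ssection.
by apply: depends_upto_ssection; exact: depends_upto_leq dA.
Qed.

Lemma cyl_content_ssection A : cylinder A ->
  nu A = \int[Q]_x nu (ssection x A).
Proof.
move=> [mA [n dA]].
have dAS : depends_upto n.+1 A by exact: depends_upto_leq dA.
rewrite (cyl_contentE Q mA dAS) iid_headS; apply: eq_integral => x _.
rewrite (@cyl_contentE _ _ n)//; first exact: measurable_ssection.
exact: depends_upto_ssection.
Qed.

Definition prefixed (n : nat) (w v : nat -> R) : nat -> R :=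
  fun i => if (i < n)%N then w i else v (i - n)%N.

Lemma prefixed_scons n w v :
  prefixed n w (scons (w n, v)) = prefixed n.+1 w v.
Proof.
apply/funext => i; rewrite /prefixed ltnS.
case: ltngtP => [//|ni|->]; last by rewrite subnn.
by rewrite -(subnSK ni).
Qed.

(** If the content were not subadditive on a cover, then some section would
inherit the defect, because sections average to the whole; fixing the
coordinates one by one in this way leads to a point that the cover misses. *)
Lemma cyl_content_sigma_subadditive : measurable_subset_sigma_subadditive nu.
Proof.
move=> A F cF cA AF; rewrite leNgt; apply/negP => FA.
pose bad (AF : set (cylinderType R) * (set (cylinderType R))^nat) :=
  [/\ cylinder AF.1, forall k, cylinder (AF.2 k) &
      \sum_(k <oo) nu (AF.2 k) < nu AF.1].
pose sec x (AF : set (cylinderType R) * (set (cylinderType R))^nat) :=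
  (ssection x AF.1, fun k => ssection x (AF.2 k)).
have [x badx] : exists x, forall AF, bad AF -> bad (sec (x AF) AF).
  suff /choice[x xP] : forall AF, exists x, bad AF -> bad (sec x AF).
    by exists x => AF0; exact: xP.
  move=> -[B G]; have [[/= cB cG GB]|] := pselect (bad (B, G)); last first.
    by exists 0%R.
  apply: contrapT => /forallNP nbad.
  move: GB; rewrite ltNge => /negP; apply.
  rewrite cyl_content_ssection//.
  under eq_eseriesr do rewrite cyl_content_ssection//.
  rewrite -integral_nneseries//; last first.
    by move=> n; exact: measurable_fun_cyl_content.
  apply: ge0_le_integral => //.
  - exact: measurable_fun_cyl_content.
  - apply: ge0_emeasurable_sum => // k _.
    exact: measurable_fun_cyl_content.
  - move=> x _; rewrite leNgt; apply/negP => secx; apply: (nbad x) => _.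
    split => //= [|k]; exact: cylinder_ssection.
(* The cylinder and its cover, after the first [n] coordinates are fixed. *)
pose st := fix st n := if n is m.+1 then sec (x (st m)) (st m) else (A, F).
pose w : nat -> R := fun n => x (st n).
have bad_st n : bad (st n) by elim: n => [|n IH]; [split|exact: badx].
have st1 n : (st n).1 = [set v | A (prefixed n w v)].
  elim: n => [|n IH]; first by apply/seteqP; split => v; rewrite /prefixed/=;
    under eq_fun do rewrite subn0.
  by rewrite /= IH; apply/seteqP; split => v;
    rewrite /ssection/= -/(w n) prefixed_scons.
have st2 n k : (st n).2 k = [set v | F k (prefixed n w v)].
  elim: n => [|n IH]; first by apply/seteqP; split => v; rewrite /prefixed/=;
    under eq_fun do rewrite subn0.
  by rewrite /= IH; apply/seteqP; split => v;
    rewrite /ssection/= -/(w n) prefixed_scons.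
have [_ [n dA]] := cA.
have Aw : A w.
  have [/= _ _ nu0] := bad_st n.
  have [[v]|/set0P/negP/negPn/eqP st0] := pselect ((st n).1 !=set0).
    by rewrite st1 /=; apply: dA => i ni; rewrite /prefixed ni.
  by move: nu0; rewrite st0 measure0 ltNge nneseries_ge0.
(* Some member of the cover contains [w]; once its coordinates are fixed it is
   everything, and its content 1 contradicts the defect. *)
have [k _ Fkw] := AF _ Aw; have [_ [m dF]] := cF k.
have [/= [mst [p dst]] _] := bad_st m; rewrite ltNge => /negP; apply.
rewrite (cyl_contentE Q mst dst); apply: le_trans (probability_le1 _ mst) _.
apply: (@le_trans _ _ (\sum_(0 <= i < k.+1) nu ((st m).2 i))); last first.
  exact: nneseries_lim_ge.
rewrite big_nat_recr//= st2 (_ : [set v | _] = setT); last first.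
  apply/seteqP; split => // v _ /=.
  by apply: dF Fkw => i im; rewrite /prefixed im.
by rewrite (@cyl_contentE _ _ 0%N)// probability_setT leeDr// sume_ge0.
Qed.

HB.instance Definition _ := Content_SigmaSubAdditive_isMeasure.Build _ R
  (cylinderType R) nu cyl_content_sigma_subadditive.

End cyl_content.

(** The extension lives on the sigma-algebra generated by the cylinders; that
it is all of the Borel sets is the measurability of the identity. *)
Definition cyl_to_RN (R : realType)
  (w : g_sigma_algebraType (@cylinder R)) : RN R := w.

Lemma measurable_cyl_to_RN (R : realType) :
  measurable_fun [set: g_sigma_algebraType (@cylinder R)] (@cyl_to_RN R).
Proof.
apply: measurable_fun_RN => i _ B mB; rewrite setTI; apply: sub_sigma_algebra.
split; first by rewrite -[X in measurable X]setTI; exact: measurable_canon_rv.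
by exists i.+1 => w w' ww' /=; rewrite /cyl_to_RN ww'.
Qed.

HB.instance Definition _ (R : realType) :=
  isMeasurableFun.Build _ _ _ _ (@cyl_to_RN R) (@measurable_cyl_to_RN R).

(** Caratheodory extension of the content, moved to the Borel sets. *)
Lemma iid_product_ex (R : realType) (Q : probability R R) :
  exists P : probability (RN R) R, forall n A, measurable A ->
    depends_upto n A -> P A = iid_head Q n A.
Proof.
pose m := measure_extension
  (cyl_content Q : {measure set (cylinderType R) -> \bar R}).
have mE A : @cylinder R A -> m A = cyl_content Q A.
  by move=> cA; rewrite /m /measure_extension/= measurable_mu_extE.
have mT : m setT = 1%E.
  rewrite mE ?(@cyl_contentE _ _ 0)// ?probability_setT//.
  by split => //; exists 0.
pose pm := Measure_isProbability.Build _ _ _ m mT.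
pose mP : probability _ R := HB.pack m pm.
exists (distribution mP (@cyl_to_RN R : {mfun _ >-> _})) => n A mA dA.
transitivity (m A) => //.
rewrite mE; last by split => //; exists n.
exact: cyl_contentE.
Qed.

(** * Disintegration *)

(** A law given by a first law followed by a kernel integrates functions
likewise. The kernel comes as a measurable family of probabilities, which is
wrapped into a bundled kernel here. *)
Section disintegration.
Context d d' d'' (X : measurableType d) (Y : measurableType d')
  (Z : measurableType d'') (R : realType).
Variables (m : probability X R) (k : X -> probability Y R).
Hypothesis mk : forall B, measurable B ->
  measurable_fun [set: X] (fun x => k x B).
Variable f : X * Y -> Z.
Hypothesis mf : measurable_fun [set: X * Y] f.
Local Open Scope ereal_scope.

Let K (x : X) : {measure set Y -> \bar R} := k x.
Let mK U : measurable U -> measurable_fun [set: X] (K ^~ U).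
Proof. exact: mk. Qed.
HB.instance Definition _ := isKernel.Build _ _ X Y R K mK.
Let K1 x : K x setT = 1. Proof. exact: probability_setT. Qed.
HB.instance Definition _ := Kernel_isProbability.Build _ _ X Y R K K1.

Lemma measurable_fun_integral_prob (g : X * Y -> \bar R) :
  measurable_fun [set: X * Y] g -> (forall z, 0 <= g z) ->
  measurable_fun [set: X] (fun x => \int[k x]_y g (x, y)).
Proof. by move=> mg g0; exact: (measurable_fun_integral_finite_kernel g K). Qed.

Let L (_ : unit) : {measure set X -> \bar R} := m.
Let mL U : measurable U -> measurable_fun [set: unit] (L ^~ U).
Proof. by move=> mU; exact: measurable_cst. Qed.
HB.instance Definition _ := isKernel.Build _ _ unit X R L mL.
Let L1 x : L x setT = 1. Proof. exact: probability_setT. Qed.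
HB.instance Definition _ := Kernel_isProbability.Build _ _ unit X R L L1.

Let mfx x : measurable_fun [set: Y] (fun y => f (x, y)).
Proof. exact: measurableT_comp. Qed.
Let M (ux : unit * X) : {measure set Z -> \bar R} :=
  distribution (k ux.2) (mfun_Sub (mem_set (mfx ux.2)) : {mfun Y >-> Z}).
Let mM U : measurable U -> measurable_fun [set: unit * X] (M ^~ U).
Proof.
move=> mU.
have : measurable_fun [set: X] (fun x => K x (xsection (f @^-1` U) x)).
  apply: measurable_fun_xsection_finite_kernel; rewrite inE.
  by rewrite -[X in measurable X]setTI; exact: mf.
move=> mKU.
rewrite (_ : M ^~ U = (fun x => K x (xsection (f @^-1` U) x)) \o snd).
  exact: measurableT_comp.
by apply/funext => -[u x]/=; rewrite /M/= /distribution/pushforward xsectionE.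
Qed.
HB.instance Definition _ := isKernel.Build _ _ (unit * X)%type Z R M mM.
Let M1 x : M x setT = 1. Proof. exact: probability_setT. Qed.
HB.instance Definition _ :=
  Kernel_isProbability.Build _ _ (unit * X)%type Z R M M1.

Lemma integral_disintegration (rho : probability Z R) (g : Z -> \bar R) :
  (forall A, measurable A -> rho A = \int[m]_x k x [set y | A (f (x, y))]) ->
  measurable_fun [set: Z] g -> (forall z, 0 <= g z) ->
  \int[rho]_z g z = \int[m]_x \int[k x]_y g (f (x, y)).
Proof.
move=> rhoE mg g0.
transitivity (\int[kcomp L M tt]_z g z).
  by apply: eq_measure_integral => A mA _; exact: rhoE.
rewrite (integral_kcomp L M)//.
apply: eq_integral => x _; rewrite /M ge0_integral_distribution//.
Qed.

End disintegration.

Lemma measurable_rcons_tuple d (T : measurableType d) n :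
  measurable_fun [set: n.-tuple T * T]
    (fun xy : n.-tuple T * T => rcons_tuple xy.1 xy.2).
Proof.
apply/measurable_fun_tnthP => i; have [ni|ni] := ltnP i n.
  rewrite (_ : _ \o _ = (@tnth _ T ^~ (Ordinal ni)) \o fst).
    exact: (measurableT_comp (measurable_tnth _)).
  apply/funext => -[x y]/=; rewrite (tnth_nth y)/= (tnth_nth y)/=.
  by rewrite nth_rcons size_tuple ni.
have {}ni : i = n :> nat by apply/eqP; rewrite eqn_leq ni -ltnS ltn_ord.
rewrite (_ : _ \o _ = snd)//; apply/funext => -[x y]/=.
by rewrite (tnth_nth y)/= nth_rcons size_tuple ni ltnn eqxx.
Qed.

Definition canon_tuple (R : realType) n (w : RN R) : n.-tuple R :=
  [tuple canon_rv i w | i < n].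

Lemma measurable_canon_tuple (R : realType) n :
  measurable_fun [set: RN R] (@canon_tuple R n).
Proof.
apply/measurable_fun_tnthP => i; rewrite (_ : _ \o _ = @canon_rv R i).
  exact: measurable_canon_rv.
by apply/funext => w; rewrite /= tnth_mktuple.
Qed.

HB.instance Definition _ (R : realType) n :=
  isMeasurableFun.Build _ _ _ _
    (@canon_tuple R n) (@measurable_canon_tuple R n).

Lemma canon_tuple_rcons (R : realType) n (w : RN R) :
  canon_tuple n.+1 w = rcons_tuple (canon_tuple n w) (canon_rv n w).
Proof.
apply/eq_from_tnth => i; rewrite tnth_mktuple (tnth_nth 0)/= nth_rcons.
rewrite size_map size_enum_ord.
case: ltngtP => [ni|ni|ni]; last by rewrite /canon_rv ni.
  by rewrite (nth_map (Ordinal ni)) ?size_enum_ord// nth_enum_ord.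
by have := ltn_ord i; rewrite ltnS leqNgt ni.
Qed.

Section iter_int.
Context (R : realType) (mu1 : probability R R) (kappa : kernel_seq R).
Hypothesis mkappa : forall n (B : set R), measurable B ->
  measurable_fun [set: n.+1.-tuple R] (fun x => kappa x B).
Variable P : probability (RN R) R.
Hypothesis PE : forall n (A : set (n.+1.-tuple R)), measurable A ->
  P [set w | A [tuple canon_rv i w | i < n.+1]] =
  iter_int mu1 kappa (fun x => (\1_A x)%:E).
Local Open Scope ereal_scope.

Lemma measurable_fun_integral_rcons n (g : n.+2.-tuple R -> \bar R) :
  measurable_fun [set: n.+2.-tuple R] g -> (forall x, 0 <= g x) ->
  measurable_fun [set: n.+1.-tuple R]
    (fun x => \int[kappa x]_y g (rcons_tuple x y)).
Proof.
move=> mg g0; have mk := @mkappa n.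
apply: (measurable_fun_integral_prob mk
  (g := fun xy => g (rcons_tuple xy.1 xy.2))) => //.
by apply: (measurableT_comp mg); exact: measurable_rcons_tuple.
Qed.

(** The finite-dimensional laws are prescribed on sets only. They extend to
nonnegative functions one kernel at a time, because a law that agrees on sets
with a composition of kernels has the same integrals. *)
Lemma iter_intE n (g : n.+1.-tuple R -> \bar R) :
  measurable_fun [set: n.+1.-tuple R] g -> (forall x, 0 <= g x) ->
  iter_int mu1 kappa g = \int[P]_w g (canon_tuple n.+1 w).
Proof.
elim: n g => [|n IH] g mg g0.
  have mt : measurable_fun [set: R] (fun x => [tuple x]).
    apply/measurable_fun_tnthP => i.
    by rewrite (_ : _ \o _ = id)//; apply/funext => x; rewrite ord1.
  transitivity (\int[distribution P (@canon_tuple R 1 : {mfun _ >-> _})]_x g x).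
    transitivity (\int[distribution mu1
        (mfun_Sub (mem_set mt) : {mfun _ >-> _})]_x g x).
      by rewrite ge0_integral_distribution.
    apply: eq_measure_integral => A mA _.
    rewrite /= /distribution /pushforward; apply/esym.
    transitivity (iter_int mu1 kappa (fun x : 1.-tuple R => (\1_A x)%:E)).
      exact: PE.
    rewrite /= -[X in mu1 X]setIT -integral_indic//.
    by rewrite -[X in measurable X]setTI; exact: mt.
  by rewrite ge0_integral_distribution.
rewrite /= IH//; last 2 first.
- exact: measurable_fun_integral_rcons.
- by move=> x; exact: integral_ge0.
rewrite -[RHS](ge0_integral_distribution
  (@canon_tuple R n.+2 : {RV P >-> _}))//.
transitivity (\int[distribution P (@canon_tuple R n.+1 : {mfun _ >-> _})]_x
    \int[kappa x]_y g (rcons_tuple x y)).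
  rewrite ge0_integral_distribution//; last by move=> x; exact: integral_ge0.
  exact: measurable_fun_integral_rcons.
apply/esym; have mk := @mkappa n.
apply: (integral_disintegration mk
  (f := fun xy => rcons_tuple xy.1 xy.2)) => //.
  exact: measurable_rcons_tuple.
move=> A mA.
have mrA (x : n.+1.-tuple R) : measurable [set y | A (rcons_tuple x y)].
  have := @measurable_rcons_tuple _ R n.+1 measurableT A mA; rewrite setTI.
  by move=> /measurable_xsection -/(_ x); rewrite xsectionE.
have mkA : measurable_fun [set: n.+1.-tuple R]
    (fun x => kappa x [set y | A (rcons_tuple x y)]).
  rewrite (_ : (fun x => _) = fun x : n.+1.-tuple R =>
    \int[kappa x]_y (\1_A (rcons_tuple x y))%:E).
    apply: (measurable_fun_integral_rcons (g := fun t => (\1_A t)%:E)).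
      by apply/measurable_EFinP; exact: measurable_indic.
    by move=> t; rewrite lee_fin.
  by apply/funext => x; rewrite -[X in kappa x X]setIT -integral_indic.
transitivity (iter_int mu1 kappa
    (fun x : n.+1.-tuple R => kappa x [set y | A (rcons_tuple x y)]));
  last first.
  by rewrite IH// ge0_integral_distribution.
transitivity (iter_int mu1 kappa (fun x : n.+2.-tuple R => (\1_A x)%:E)).
  exact: PE.
rewrite /=; congr iter_int; apply/funext => x.
by rewrite -[X in kappa x X]setIT -integral_indic.
Qed.

End iter_int.

(** * Partial sums under an i.i.d. family *)

(** Constant kernels: the infinite product of [Q] belongs to the family that
only uses [Q], hence to every family that allows [Q]. *)
Lemma iid_product_probs (R : realType) (Q : probability R R) :
  exists P : probability (RN R) R, iid_probs [set Q] P.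
Proof.
have [P PE] := iid_product_ex Q.
exists P, Q, (fun n _ => Q); split => // n A mA.
rewrite (PE n.+1); last 2 first.
- have := @measurable_canon_tuple R n.+1 measurableT A mA.
  by rewrite setTI.
- move=> w w' ww' /=; rewrite (_ : [tuple _ | i < _] = canon_tuple n.+1 w')//.
  by apply/eq_from_tnth => i; rewrite !tnth_mktuple /canon_rv ww'.
have iterE m (g : m.+1.-tuple R -> \bar R) :
    measurable_fun [set: m.+1.-tuple R] g -> (forall x, 0 <= g x)%E ->
    iter_int Q (fun n _ => Q) g =
    (\int[iid_head Q m.+1]_w g (canon_tuple m.+1 w))%E.
  elim: m g => [|m IH] g mg g0.
    rewrite integral_iid_headS//; last first.
      exact: (measurableT_comp mg (@measurable_canon_tuple R 1)).
    apply: eq_integral => x _.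
    rewrite [RHS]integral_dirac//; last first.
      apply: (measurableT_comp mg).
      apply: (measurableT_comp (@measurable_canon_tuple R 1)).
      exact: (measurableT_comp (@measurable_scons R)).
    rewrite diracT mul1e; congr g; apply/eq_from_tnth => i.
    by rewrite tnth_mktuple ord1.
  have mgr : measurable_fun [set: m.+1.-tuple R * R]
      (fun xy => g (rcons_tuple xy.1 xy.2)).
    exact: (measurableT_comp mg (@measurable_rcons_tuple _ R m.+1)).
  rewrite [LHS]/= IH; last 2 first.
  - exact: (measurable_fun_fubini_tonelli_F (m2 := Q) _ mgr).
  - by move=> x; apply: integral_ge0 => y _; exact: g0.
  rewrite [RHS]integral_iid_head_last; last 2 first.

  - exact: (measurableT_comp mg (@measurable_canon_tuple R m.+2)).
  - by move=> w; exact: g0.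
  apply: eq_integral => w _; apply: eq_integral => y _; congr g.
  rewrite [RHS]canon_tuple_rcons; congr rcons_tuple; last first.
    by rewrite /canon_rv /supd eqxx.
  apply/eq_from_tnth => i; rewrite !tnth_mktuple /canon_rv /supd.
  by case: eqP => // im; have := ltn_ord i; rewrite im ltnn.
rewrite iterE; last 2 first.
- by apply/measurable_EFinP; exact: measurable_indic.
- by move=> x; rewrite lee_fin.
rewrite -[X in iid_head _ _ X]setIT -integral_indic//.
have := @measurable_canon_tuple R n.+1 measurableT A mA.
by rewrite setTI.
Qed.

Definition psum (R : realType) (f : R -> R) (n : nat) (w : RN R) : R :=
  \sum_(i < n) f (canon_rv i w).

Lemma measurable_psum (R : realType) (f : R -> R) n :
  measurable_fun [set: R] f -> measurable_fun [set: RN R] (psum f n).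
Proof.
move=> mf; apply: measurable_sum => i.
by apply: measurableT_comp => //; exact: measurable_canon_rv.
Qed.

Lemma integral_prob_cst d (T : measurableType d) (R : realType)
  (P : probability T R) (c : \bar R) : (\int[P]_x c = c)%E.
Proof. by rewrite (integral_cst P measurableT)/= probability_setT mule1. Qed.

Section conditional.
Context (R : realType) (P1 : set (probability R R)) (P : probability (RN R) R).
Hypothesis iidP : iid_probs P1 P.
Local Open Scope ereal_scope.

(** Given the first [n] terms, the next one has a law [k w] in [P1]. Only
functions of the sum of these terms and of the next one are ever integrated,
so the two are the only variables of [F]. *)
Lemma iid_probs_cond n :
  exists k : RN R -> probability R R, (forall w, P1 (k w)) /\
  forall (f : R -> R) (F : R * R -> \bar R), measurable_fun [set: R] f ->
    measurable_fun [set: R * R] F -> (forall z, 0 <= F z) ->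
    measurable_fun [set: RN R] (fun w => \int[k w]_y F (psum f n w, y)) /\
    \int[P]_w F (psum f n w, canon_rv n w) =
    \int[P]_w \int[k w]_y F (psum f n w, y).
Proof.
have [mu1 [kappa [P1mu1 kap PE]]] := iidP.
have mkappa m (B : set R) : measurable B ->
    measurable_fun [set: m.+1.-tuple R] (fun x => kappa m x B).
  by move=> mB; have [mk _] := kap m; exact: mk.
case: n => [|n].
  exists (fun=> mu1); split => // f F mf mF F0.
  have mF0 : measurable_fun [set: 1.-tuple R] (fun t => F (0%R, tnth t ord0)).
    apply: (measurableT_comp mF); apply/measurable_fun_pairP; split.
      exact: measurable_cst.
    exact: measurable_tnth.
  have -> : psum f 0 = (fun=> 0%R) by apply/funext => w; rewrite /psum big_ord0.
  split; first exact: measurable_cst.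
  rewrite [RHS]integral_prob_cst.
  have := iter_intE mkappa PE mF0 (fun t => F0 _); rewrite /= => ->.
  by apply: eq_integral => w _; rewrite tnth_mktuple.
exists (fun w => kappa n (canon_tuple n.+1 w)); split.
  by move=> w; have [_] := kap n; exact.
move=> f F mf mF F0.
pose s m (t : seq R) := (\sum_(i < m) f (nth 0%R t i))%R.
have sE m w : s m (canon_tuple m w) = psum f m w.
  by apply: eq_bigr => i _; rewrite -tnth_nth tnth_mktuple.
pose g (t : n.+2.-tuple R) := F (s n.+1 t, nth 0%R t n.+1).
have mnth m i : (i < m)%N -> 
      measurable_fun [set: m.-tuple R] (fun t : m.-tuple R => nth 0%R t i).
  move=> im; have -> : (fun t : m.-tuple R => nth 0%R t i) =
      (@tnth m R ^~ (Ordinal im)).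
    by apply/funext => t; rewrite (tnth_nth 0%R).
  exact: measurable_tnth.
have mg : measurable_fun [set: n.+2.-tuple R] g.
  apply: (measurableT_comp mF); apply/measurable_fun_pairP; split.
    apply: measurable_sum => i; apply: (measurableT_comp mf).
    by apply: mnth; rewrite ltnS ltnW.
  exact: mnth.
have gr (x : n.+1.-tuple R) y : g (rcons_tuple x y) = F (s n.+1 x, y).
  rewrite /g /= nth_rcons size_tuple ltnn eqxx; congr (F (_, _)).
  by apply: eq_bigr => i _; rewrite nth_rcons size_tuple ltn_ord.
have g0 t : 0 <= g t by exact: F0.
have mk := measurable_fun_integral_rcons mkappa mg g0.
split.
  rewrite (_ : (fun w => _) = (fun x : n.+1.-tuple R =>
    \int[kappa n x]_y g (rcons_tuple x y)) \o @canon_tuple R n.+1).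
    exact: measurableT_comp.
  apply/funext => w /=; apply: eq_integral => y _.
  by rewrite gr sE.
have := iter_intE mkappa PE mg g0.
rewrite /= (iter_intE mkappa PE mk); last first.
  by move=> x; exact: integral_ge0.
move=> gE; transitivity (\int[P]_w g (canon_tuple n.+2 w)).
  apply: eq_integral => w _; rewrite canon_tuple_rcons gr sE//.
rewrite -gE; apply: eq_integral => w _; apply: eq_integral => y _.
by rewrite gr sE.
Qed.

Lemma psumS f n w : psum f n.+1 w = (psum f n w + f (canon_rv n w))%R :> R.
Proof. by rewrite /psum big_ord_recr. Qed.

(** The conditional expectation is at most its value for the worst law of
[P1]. *)
Lemma psum_step_le (f : R -> R) (F G : R -> \bar R) n :
  measurable_fun [set: R] f ->
  measurable_fun [set: R] F -> (forall s, 0 <= F s) ->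
  measurable_fun [set: R] G ->
  (forall s Q, P1 Q -> \int[Q]_y F (s + f y)%R <= G s) ->
  \int[P]_w F (psum f n.+1 w) <= \int[P]_w G (psum f n w).
Proof.
move=> mf mF F0 mG FG; have [k [P1k kE]] := iid_probs_cond n.
have mF' : measurable_fun [set: R * R] (fun z => F (z.1 + f z.2)%R).
  apply: (measurableT_comp mF); apply: measurable_funD => //.
  exact: (measurableT_comp mf).
have [mk {}kE] := kE _ _ mf mF' (fun z => F0 _).
under eq_integral do rewrite psumS.
rewrite [leLHS]kE; apply: ge0_le_integral => //.
- by move=> w _; exact: integral_ge0.
- by apply: (measurableT_comp mG); exact: measurable_psum.
- by move=> w _; exact: FG.
Qed.

(** The method of potentials: no martingale is needed, since a potential that
each law of [P1] raises by at most [c] on average does so whatever the past. *)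
Lemma psum_growth (f H : R -> R) (c : R) n :
  measurable_fun [set: R] f -> measurable_fun [set: R] H ->
  (forall s, 0 <= H s)%R -> (0 <= c)%R ->
  (forall s Q, P1 Q -> \int[Q]_y (H (s + f y))%:E <= (H s + c)%:E) ->
  \int[P]_w (H (psum f n w))%:E <= (H 0 + n%:R * c)%:E.
Proof.
move=> mf mH H0 c0 Hc; elim: n => [|n IH].
  under eq_integral do rewrite /psum big_ord0.
  by rewrite integral_prob_cst mul0r addr0.
have mHE : measurable_fun [set: R] (EFin \o H) by exact/measurable_EFinP.
apply: (@le_trans _ _ (\int[P]_w (H (psum f n w) + c)%:E)).
  apply: (@psum_step_le f (EFin \o H) (fun s => (H s + c)%:E)) => //.
  by apply/measurable_EFinP; exact: measurable_funD.
under eq_integral do rewrite EFinD.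
rewrite ge0_integralD//; last 2 first.
- by move=> w _; rewrite lee_fin.
- by apply: (measurableT_comp mHE); exact: measurable_psum.
rewrite integral_prob_cst.
by rewrite -natr1 mulrDl mul1r addrA EFinD leeD.
Qed.

End conditional.

(** * Bounded measurable functions *)

(** These functions are integrable for every probability, so that their
integrals are real numbers with the usual linearity. *)
Definition bmfun d (T : measurableType d) (R : realType) (g : T -> R) :=
  measurable_fun [set: T] g /\ exists B, forall x, `|g x| <= B.

Lemma measurable_ge d (T : measurableType d) (R : realType) (g : T -> R)
  (a : R) :
  measurable_fun [set: T] g -> measurable [set x | a <= g x].
Proof.
move=> mg; rewrite -[X in measurable X]setTI.
rewrite (_ : [set x | a <= g x] = g @^-1` [set` `[a, +oo[%R]); first exact: mg.
by apply/seteqP; split => x /=; rewrite in_itv/= andbT.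
Qed.

Lemma prob_le d (T : measurableType d) (R : realType) (P : probability T R)
    (A B : set T) : measurable A -> measurable B -> A `<=` B ->
  fine (P A) <= fine (P B).
Proof.
by move=> mA mB AB; rewrite fine_le ?fin_num_measure// le_measure ?inE.
Qed.

Section bmfun.
Context d (T : measurableType d) (R : realType) (P : probability T R).
Implicit Types g h : T -> R.

Lemma bmfun_cst (c : R) : bmfun (fun _ : T => c).
Proof. by split; [exact: measurable_cst|exists `|c|]. Qed.

Lemma bmfunD g h : bmfun g -> bmfun h -> bmfun (fun x => g x + h x).
Proof.
move=> [mg [B gB]] [mh [C hC]]; split; first exact: measurable_funD.
by exists (B + C) => x; rewrite (le_trans (ler_normD _ _))// lerD.
Qed.

Lemma bmfunM g h : bmfun g -> bmfun h -> bmfun (fun x => g x * h x).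
Proof.
move=> [mg [B gB]] [mh [C hC]]; split; first exact: measurable_funM.
by exists (B * C) => x; rewrite normrM ler_pM.
Qed.

Lemma bmfunZ (c : R) g : bmfun g -> bmfun (fun x => c * g x).
Proof. by apply: bmfunM; exact: bmfun_cst. Qed.

Lemma bmfun_indic (A : set T) : measurable A -> bmfun (\1_A : T -> R).
Proof.
move=> mA; split; first exact: measurable_indic.
by exists 1 => x; rewrite indicE; case: (x \in A); rewrite ?normr1// normr0.
Qed.

Lemma bmfun_integrable g : bmfun g -> P.-integrable [set: T] (EFin \o g).
Proof.
move=> [mg [B gB]]; apply: measurable_bounded_integrable => //.
  by rewrite /= probability_setT ltry.
by exists B; split; [exact: num_real|move=> M BM x _; exact: le_trans (ltW BM)].
Qed.

Lemma bmfun_integralE g : bmfun g ->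
  (\int[P]_x (g x)%:E = (\int[P]_x g x)%:E)%E.
Proof.
move=> bg; rewrite fineK//; exact: integrable_fin_num (bmfun_integrable bg).
Qed.

Lemma bmfun_le g h : bmfun g -> bmfun h -> (forall x, g x <= h x) ->
  \int[P]_x g x <= \int[P]_x h x.
Proof.
by move=> bg bh gh; apply: le_Rintegral => //; exact: bmfun_integrable.
Qed.

Lemma bmfun_intD g h : bmfun g -> bmfun h ->
  \int[P]_x (g x + h x) = \int[P]_x g x + \int[P]_x h x.
Proof. by move=> bg bh; apply: RintegralD => //; exact: bmfun_integrable. Qed.

Lemma bmfun_intZ (c : R) g : bmfun g -> \int[P]_x (c * g x) = c * \int[P]_x g x.
Proof. by move=> bg; apply: RintegralZl => //; exact: bmfun_integrable. Qed.

Lemma Rintegral_prob_cst (c : R) : \int[P]_x c = c.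
Proof. by rewrite /Rintegral integral_prob_cst. Qed.

Lemma Rintegral_prob_indic (A : set T) : measurable A ->
  \int[P]_x (\1_A x) = fine (P A).
Proof. by move=> mA; rewrite /Rintegral integral_indic// setIT. Qed.

Lemma prob_le1 (A : set T) : measurable A -> fine (P A) <= 1.
Proof.
move=> mA; rewrite -lee_fin fineK ?fin_num_measure//; exact: probability_le1.
Qed.

Lemma prob_markov g (a b : R) : measurable_fun [set: T] g ->
  (forall x, 0 <= g x) -> 0 < a -> (\int[P]_x (g x)%:E <= b%:E)%E ->
  fine (P [set x | a <= g x]) <= b / a.
Proof.
move=> mg g0 a0 gb.
have mA : measurable [set x | a <= g x] by exact: measurable_ge.
rewrite ler_pdivlMr// -lee_fin EFinM fineK ?fin_num_measure//.
apply: le_trans gb; rewrite muleC -integral_cst//.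
rewrite integral_mkcond; apply: ge0_le_integral => //.
- move=> x _; rewrite patchE; case: ifP => // _; rewrite lee_fin; exact: ltW.
- apply/(measurable_restrictT _ _).1 => //; exact: measurable_cst.
- exact/measurable_EFinP.
- by move=> x _; rewrite patchE; case: ifPn => [/set_mem//|_]; rewrite lee_fin.
Qed.

End bmfun.
#[global] Hint Resolve bmfun_cst : core.

(** * Truncation *)

Section clip.
Context (R : realType).
Implicit Types (K x y : R) (Q : probability R R).

Definition clip K x := Num.min (Num.max (- K) x) K.

Lemma clip_norm K x : `|clip K x| <= `|K|.
Proof.
rewrite /clip ler_norml; have := ler_norm K; have := ler_norm (- K).
rewrite normrN; case: (leP (- K) x) => a.
  by case: (leP x K) => b c d; apply/andP; split; lra.
by case: (leP (- K) K) => b c d; apply/andP; split; lra.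
Qed.

Lemma clip_id K x : `|x| <= K -> clip K x = x.
Proof. by rewrite ler_norml => /andP[a b]; rewrite /clip max_r// min_l. Qed.

Lemma clipN K x : 0 <= K -> clip K (- x) = - clip K x.
Proof.
move=> K0; rewrite /clip.
case: (leP (- K) x) => a; case: (leP (- K) (- x)) => b.
- by case: (leP x K) => c; case: (leP (- x) K) => d; lra.
- by case: (leP x K) => c; case: (leP (- K) K) => d; lra.
- by case: (leP (- K) K) => c; case: (leP (- x) K) => d; lra.
- by case: (leP (- K) K) => c; lra.
Qed.

Lemma clip_norm_eq K x : 0 <= K -> K <= `|x| -> `|clip K x| = K.
Proof.
move=> K0; rewrite ler_normr => /orP[Kx|xK].
  by rewrite /clip min_r ?ger0_norm// le_max Kx orbT.
by rewrite /clip max_l ?min_l ?normrN ?ger0_norm//; lra.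
Qed.

Lemma bmfun_clip K : bmfun (clip K : R -> R).
Proof.
split; last by exists `|K| => x; exact: clip_norm.
apply: measurable_minr; last exact: measurable_cst.
apply: measurable_maxr => //; exact: measurable_cst.
Qed.

Lemma measurable_norm_ge K : measurable [set y : R | K <= `|y|].
Proof. by apply: measurable_ge; exact: normr_measurable. Qed.

Definition ptail (Q : probability R R) K : R := fine (Q [set y | K <= `|y|]).

Lemma ptail_ge0 Q K : 0 <= ptail Q K.
Proof. exact: fine_ge0. Qed.

(** Below [n] the two truncations agree, and above it their squares are [n^2]
and at most [(n + 1)^2]. *)
Lemma clip_sqrS Q (n : nat) :
  \int[Q]_x (clip n.+1%:R x ^+ 2) <=
  \int[Q]_x (clip n%:R x ^+ 2) + (2 * n%:R + 1) * ptail Q n%:R.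
Proof.
have bs K : bmfun (fun x => clip K x ^+ 2) by apply: bmfunM; exact: bmfun_clip.
have mA := measurable_norm_ge n%:R.
rewrite /ptail -Rintegral_prob_indic// -bmfun_intZ; last exact: bmfun_indic.
rewrite -bmfun_intD//; last by apply: bmfunZ; exact: bmfun_indic.
apply: bmfun_le => //.
  by apply: bmfunD => //; apply: bmfunZ; exact: bmfun_indic.
move=> x; rewrite indicE; case: (leP n%:R `|x|) => nx.
  rewrite mem_set//= mulr1 -[X in X <= _]real_normK ?num_real//.
  rewrite -[X in _ <= X + _]real_normK ?num_real// (clip_norm_eq _ nx)//.
  have := clip_norm n.+1%:R x; rewrite normr_nat => cx.
  apply: le_trans (_ : n.+1%:R ^+ 2 <= _); first by rewrite lerXn2r// nnegrE.
  by rewrite -natr1; lra.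
rewrite memNset/=; last by apply/negP; rewrite -ltNge.
rewrite mulr0 addr0 !clip_id//; first exact: ltW.
by apply/ltW; rewrite (lt_trans nx)// ltr_nat.
Qed.

(** Summing the increments from [N] on, each of which is at most [3 eps]; the
truncation at [N] itself has second moment at most [N^2]. *)
Lemma clip_sqr_le Q (eps : R) (N n : nat) : 0 <= eps -> (0 < N)%N ->
  (forall k, (N <= k)%N -> k%:R * ptail Q k%:R <= eps) -> (N <= n)%N ->
  \int[Q]_x (clip n%:R x ^+ 2) <= N%:R ^+ 2 + 3 * eps * n%:R.
Proof.
move=> e0 N0 tN; elim: n => [|n IH]; first by rewrite leqNgt N0.
rewrite leq_eqVlt => /predU1P[<-|Nn].
  apply: le_trans (_ : \int[Q]_x (N%:R ^+ 2) <= _).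
    apply: bmfun_le => // [|x]; first by apply: bmfunM; exact: bmfun_clip.
    rewrite -[X in X <= _]real_normK ?num_real// lerXn2r// ?nnegrE//.
    by rewrite (le_trans (clip_norm _ _))// normr_nat.
  by rewrite Rintegral_prob_cst lerDl !mulr_ge0.
apply: le_trans (clip_sqrS _ _) _.
have {}IH := IH Nn; have tn := tN n Nn.
have n1 : 1 <= n%:R :> R by rewrite ler1n (leq_trans N0).
have : (2 * n%:R + 1) * ptail Q n%:R <= 3 * (n%:R * ptail Q n%:R).
  by rewrite mulrA ler_wpM2r ?ptail_ge0//; lra.
by rewrite -natr1; lra.
Qed.

End clip.

(** * Tails of the partial sums *)

Section tails.
Context (R : realType) (P1 : set (probability R R)) (P : probability (RN R) R).
Hypothesis iidP : iid_probs P1 P.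

(** The square of the positive part is convex with second derivative at most
2, so that a step of nonpositive mean raises its mean by at most the second
moment of the step, whatever the past. *)
Lemma psum_tail (f : R -> R) (c t : R) n : bmfun f -> 0 <= c ->
  (forall Q, P1 Q -> \int[Q]_y f y <= 0) ->
  (forall Q, P1 Q -> \int[Q]_y (f y ^+ 2) <= c) -> 0 < t ->
  fine (P [set w | t <= psum f n w]) <= n%:R * c / t ^+ 2.
Proof.
move=> bf c0 f0 fc t0; pose H (s : R) := Num.max s 0 ^+ 2.
have mmax : measurable_fun [set: R] (fun s : R => Num.max s 0).
  by apply: measurable_maxr => //; exact: measurable_cst.
have mH : measurable_fun [set: R] H.
  exact: measurable_funX mmax.
have H0 s : 0 <= H s by exact: sqr_ge0.
have HE x y : H (x + y) <= H x + 2 * Num.max x 0 * y + y ^+ 2.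
  rewrite /H; case: (leP x 0) => x0; case: (leP (x + y) 0) => xy0; nra.
have step s Q : P1 Q -> (\int[Q]_y (H (s + f y))%:E <= (H s + c)%:E)%E.
  move=> P1Q; have [mf [B fB]] := bf.
  have bf2 : bmfun (fun y => f y ^+ 2) by exact: bmfunM.
  have bS : bmfun (fun y => H s + 2 * Num.max s 0 * f y + f y ^+ 2).
    by apply: bmfunD => //; apply: bmfunD => //; exact: bmfunZ.
  have bH : bmfun (fun y => H (s + f y)).
    split.
      apply: (measurableT_comp mH); apply: measurable_funD => //.
    have [C SC] := bS.2; exists C => y; rewrite ger0_norm//.
    by apply: le_trans (HE _ _) _; exact: le_trans (ler_norm _) (SC y).
  rewrite bmfun_integralE// lee_fin.
  apply: le_trans (bmfun_le Q bH bS _) _ => //.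
  rewrite bmfun_intD//; last by apply: bmfunD => //; exact: bmfunZ.
  rewrite bmfun_intD//; last exact: bmfunZ.
  rewrite Rintegral_prob_cst bmfun_intZ// -addrA lerD2l.
  have := f0 _ P1Q; have := fc _ P1Q.
  have : 0 <= Num.max s 0 by rewrite le_max lexx orbT.
  by set u := Num.max s 0; move=> u0 a b; have : u * \int[Q]_y f y <= 0; nra.
have mP : measurable_fun [set: RN R] (psum f n).
  by apply: measurable_psum; have [] := bf.
have := psum_growth iidP n bf.1 mH H0 c0 step.
rewrite (_ : H 0 = 0) ?add0r; last by rewrite /H max_l// expr0n.
move=> /(prob_markov (measurableT_comp mH mP) (fun w => H0 _) (exprn_gt0 2 t0)).
apply: le_trans; apply: prob_le.
- exact: measurable_ge.
- exact: measurable_ge (measurableT_comp mH mP).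
move=> w /= tw; rewrite /H max_l ?lerXn2r ?nnegrE//; lra.
Qed.

(** The sum counts the terms of size at least [K]; its mean is at most
[n * dl]. *)
Lemma big_jump_tail (K dl : R) n : 0 <= dl ->
  (forall Q, P1 Q -> ptail Q K <= dl) ->
  fine (P [set w | 1 <= psum (\1_[set y | K <= `|y|]) n w]) <= n%:R * dl.
Proof.
move=> d0 tQ; set f := \1_ _.
have mA := measurable_norm_ge K.
have bf : bmfun f by exact: bmfun_indic.
have f0 y : 0 <= f y by rewrite /f indicE.
have mN : measurable_fun [set: R] (fun s : R => `|s|).
  exact: normr_measurable.
have step s Q : P1 Q -> (\int[Q]_y (`|s + f y|)%:E <= (`|s| + dl)%:E)%E.
  move=> P1Q; have bs : bmfun (fun y => `|s| + f y) by exact: bmfunD.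
  have bN : bmfun (fun y => `|s + f y|).
    split.
      by apply: (measurableT_comp mN); apply: measurable_funD => //; case: bf.
    have [B sB] := bs.2; exists B => y; rewrite normr_id.
    apply: le_trans (sB y).
    by rewrite (le_trans (ler_normD _ _))// (ger0_norm (f0 y)) ler_norm.
  rewrite bmfun_integralE// lee_fin.
  apply: (@le_trans _ _ (\int[Q]_y (`|s| + f y))).
    apply: bmfun_le => // y.
    by rewrite (le_trans (ler_normD _ _))// (ger0_norm (f0 y)).
  rewrite bmfun_intD// Rintegral_prob_cst lerD2l Rintegral_prob_indic//.
  exact: tQ.
have mP : measurable_fun [set: RN R] (psum f n).
  by apply: measurable_psum; have [] := bf.
have := psum_growth iidP n bf.1 mN (fun s => normr_ge0 s) d0 step.
rewrite normr0 add0r.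
move=> /(prob_markov (measurableT_comp mN mP) (fun w => normr_ge0 _) ltr01).
rewrite divr1; apply: le_trans; apply: prob_le.
- exact: measurable_ge.
- exact: measurable_ge (measurableT_comp mN mP).
by move=> w /= h; exact: le_trans (ler_norm _).
Qed.

(** A sum exceeds its bound either because a term is truncated or because the
truncated sum does. *)
Lemma psum_id_tail (s a K c dl eta : R) n : (0 < n)%N -> 0 <= dl -> 0 <= c ->
  0 < eta ->
  (forall Q, P1 Q -> s * \int[Q]_y clip K y <= a) ->
  (forall Q, P1 Q -> \int[Q]_y ((s * clip K y - a) ^+ 2) <= c) ->
  (forall Q, P1 Q -> ptail Q K <= dl) ->
  fine (P [set w | n%:R * (a + eta) <= s * psum id n w]) <=
  n%:R * dl + c / (n%:R * eta ^+ 2).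
Proof.
move=> n0 d0 c0 e0 sa sc tQ; pose f y := s * clip K y - a.
have nR0 : 0 < n%:R :> R by rewrite ltr0n.
have bf : bmfun f by apply: bmfunD => //; apply: bmfunZ; exact: bmfun_clip.
have jump := big_jump_tail n d0 tQ.
have f0 Q : P1 Q -> \int[Q]_y f y <= 0.
  have bc : bmfun (fun y => s * clip K y) by apply: bmfunZ; exact: bmfun_clip.
  move=> P1Q; rewrite bmfun_intD//.
  rewrite bmfun_intZ ?Rintegral_prob_cst; last exact: bmfun_clip.
  by rewrite subr_le0; exact: sa.
have := psum_tail n bf c0 f0 sc (mulr_gt0 nR0 e0).
have -> : n%:R * c / (n%:R * eta) ^+ 2 = c / (n%:R * eta ^+ 2).
  by field; rewrite gt_eqF//= gt_eqF.
move=> tail; apply: le_trans (lerD jump tail).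
set A := [set w | _]; set B := [set w | _]; set C := [set w | _].
have mi : measurable_fun [set: RN R] (psum id n) by exact: measurable_psum.
have mA : measurable A by apply: measurable_ge; exact: measurable_funM.
have mB : measurable B.
  apply: measurable_ge; apply: measurable_psum.
  exact: measurable_indic (measurable_norm_ge K).
have mC : measurable C.
  by apply: measurable_ge; apply: measurable_psum; case: bf.
apply: (@le_trans _ _ (fine (P (B `|` C)))).
  apply: prob_le => //; first exact: measurableU.
  move=> w Aw; have [?|nB] := pselect (B w); [by left|right].
  have small (i : 'I_n) : `|canon_rv i w| <= K.
    rewrite leNgt; apply/negP => Kw; apply: nB.
    rewrite /B /= /psum (bigD1 i)//=.
    rewrite indicE mem_set/=; last exact: ltW.
    by rewrite lerDl sumr_ge0// => j _; rewrite indicE.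
  move: Aw; rewrite /A /C /= /psum mulr_sumr.
  have -> : \sum_(i < n) f (canon_rv i w) =
      \sum_(i < n) s * canon_rv i w - n%:R * a.
    rewrite /f big_split /= sumrN sumr_const card_ord mulr_natl; congr (_ - _).
    by apply: eq_bigr => i _; rewrite clip_id.
  by rewrite mulrDr; lra.
rewrite -fineD ?fin_num_measure// fine_le ?fin_num_measure//.
- exact: measurableU.
- by rewrite fin_numD !fin_num_measure.
exact: measureU2.
Qed.

End tails.

Definition tails_vanish (R : realType) (P0 : set (probability R R)) :=
  forall eps : R, 0 < eps -> exists N, forall n Q, (N <= n)%N -> P0 Q ->
    n%:R * ptail Q n%:R <= eps.

(** The uniform weak law. Vanishing tails make the second moments of the
truncations at [n] of order less than [n], so that Chebyshev's inequality wins,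
and make a truncation improbable. Taking for [P1] all of [P0] bounds every law
of the family, taking a single law gives the classical weak law for it, and
[s = 1] and [s = -1] give the two sides. *)
Lemma unif_tail (R : realType) (P0 : set (probability R R)) :
  tails_vanish P0 ->
  forall C eta eps : R, 0 < eta -> 0 < eps -> exists N, forall n, (N <= n)%N ->
    (0 < n)%N /\ forall P1 P s a, P1 `<=` P0 -> iid_probs P1 P ->
      `|s| <= 1 -> `|a| <= C ->
      (forall Q, P1 Q -> s * \int[Q]_y clip n%:R y <= a) ->
      fine (P [set w | n%:R * (a + eta) <= s * psum id n w]) <= eps.
Proof.
move=> U C eta eps eta0 eps0.
(* Truncations cost [e <= eps / 4]. In the variance, the part that grows with
   [n] costs [6 * e / eta ^ 2 <= eps / 4], and the constant part costs [eps / 4]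
   once [n] exceeds [D]. *)
pose e := Num.min (eps / 4) (eps * eta ^+ 2 / 24).
have e0 : 0 < e by rewrite lt_min !divr_gt0// mulr_gt0// exprn_gt0.
have [N1 N1P] := U e e0.
pose N := maxn N1 1.
pose D : R := (2 * N%:R ^+ 2 + 2 * C ^+ 2) / (eta ^+ 2 * (eps / 4)).
exists (maxn N (Num.bound `|D|)) => n; rewrite geq_max => /andP[Nn Dn].
have n0 : (0 < n)%N by rewrite (leq_trans _ Nn)// leq_maxr.
split => // P1 P s a P10 iidP s1 aC sa.
have nR0 : 0 < n%:R :> R by rewrite ltr0n.
have tN Q k : P0 Q -> (N <= k)%N -> k%:R * ptail Q k%:R <= e.
  by move=> P0Q Nk; apply: N1P => //; apply: leq_trans Nk; exact: leq_maxl.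
have clip2 Q : P1 Q -> \int[Q]_y (clip n%:R y ^+ 2) <= N%:R ^+ 2 + 3 * e * n%:R.
  move=> P1Q; apply: clip_sqr_le => //; [exact: ltW|by rewrite leq_maxr|].
  by move=> k; apply: tN; exact: P10.
have bc : bmfun (fun y => clip n%:R y ^+ 2 : R).
  by apply: bmfunM; exact: bmfun_clip.
have var Q : P1 Q -> \int[Q]_y ((s * clip n%:R y - a) ^+ 2) <=
    2 * (N%:R ^+ 2 + 3 * e * n%:R) + 2 * C ^+ 2.
  move=> P1Q.
  apply: (@le_trans _ _ (\int[Q]_y (2 * (clip n%:R y ^+ 2) + 2 * C ^+ 2))).
    apply: bmfun_le.
    - have b1 : bmfun (fun y => s * clip n%:R y - a : R).
        by apply: bmfunD; [apply: bmfunZ; exact: bmfun_clip|exact: bmfun_cst].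
      exact: bmfunM.
    - by apply: bmfunD => //; exact: bmfunZ.
    move=> y; have a2 : a ^+ 2 <= C ^+ 2.
      rewrite -[a ^+ 2]real_normK ?num_real// lerXn2r// nnegrE//.
      exact: le_trans aC.
    have s2 : s ^+ 2 <= 1 by rewrite -[s ^+ 2]real_normK ?num_real// expr_le1.
    have : (s * clip n%:R y) ^+ 2 <= clip n%:R y ^+ 2.
      by rewrite exprMn ler_piMl// sqr_ge0.
    set z := s * _ => zz; have := sqr_ge0 (z + a); nra.
  rewrite bmfun_intD ?bmfun_intZ ?Rintegral_prob_cst//; last exact: bmfunZ.
  by have := clip2 _ P1Q; lra.
have c0 : 0 <= 2 * (N%:R ^+ 2 + 3 * e * n%:R) + 2 * C ^+ 2.
  rewrite addr_ge0// mulr_ge0// ?sqr_ge0// addr_ge0 ?sqr_ge0//.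
  by rewrite !mulr_ge0// ltW.
have tl Q : P1 Q -> ptail Q n%:R <= e / n%:R.
  by move=> P1Q; rewrite ler_pdivlMr// mulrC; apply: tN => //; exact: P10.
have en0 : 0 <= e / n%:R by rewrite divr_ge0// ltW.
apply: le_trans (psum_id_tail iidP n0 en0 c0 eta0 sa var tl) _.
rewrite mulrCA divff ?gt_eqF// mulr1.
have e1 : e <= eps / 4 by rewrite /e ge_min lexx.
have e2 : e <= eps * eta ^+ 2 / 24 by rewrite /e ge_min lexx orbT.
have eta2 : 0 < eta ^+ 2 by rewrite exprn_gt0.
have Dn' : D <= n%:R.
  apply: le_trans (ler_norm _) _.
  by apply: le_trans (ltW (archi_boundP (normr_ge0 D))) _; rewrite ler_nat.
have : D * (eta ^+ 2 * (eps / 4)) <= n%:R * (eta ^+ 2 * (eps / 4)).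
  by rewrite ler_wpM2r// mulr_ge0// ?divr_ge0// ltW.
rewrite /D divfK; last by rewrite gt_eqF// mulr_gt0// divr_gt0.
move=> h; have : (2 * (N%:R ^+ 2 + 3 * e * n%:R) + 2 * C ^+ 2) /
    (n%:R * eta ^+ 2) <= eps / 2.
  rewrite ler_pdivrMr ?mulr_gt0//.
  have em : e * n%:R <= eps * eta ^+ 2 / 24 * n%:R by rewrite ler_wpM2r// ltW.
  set Z := n%:R * (eta ^+ 2 * (eps / 4)) in h.
  have -> : eps / 2 * (n%:R * eta ^+ 2) = 2 * Z by rewrite /Z; field.
  have {}em : e * n%:R <= Z / 6.
    rewrite (_ : Z / 6 = eps * eta ^+ 2 / 24 * n%:R)//.
    by rewrite /Z; field.
  rewrite -(mulrA 3 e); lra.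
lra.
Qed.

(** * Limits of suprema of expectations *)

Section limits.
Context (R : realType).

Lemma ereal_cvg_approx (u : nat -> \bar R) (l : R) :
  u @ \oo --> l%:E <->
  forall eps : R, 0 < eps -> exists N, forall n, (N <= n)%N ->
    ((l - eps)%:E <= u n <= (l + eps)%:E)%E.
Proof.
split=> [/fine_cvgP[ufin /cvgrPdist_le ul] eps e0|ul].
  have [N _ NP] : \forall n \near \oo,
      u n \is a fin_num /\ `|l - (fine \o u) n| <= eps.
    by apply: filterI => //; exact: ul.
  exists N => n Nn; have [/fineK <-] := NP n Nn.
  by rewrite !lee_fin /= ler_distl; lra.
apply/fine_cvgP; split.
  have [N NP] := ul 1 ltr01; exists N => // n /= Nn.
  have /andP[a b] := NP n Nn.
  by rewrite fin_real// (lt_le_trans _ a) ?ltNyr// (le_lt_trans b) ?ltry.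
apply/cvgrPdist_le => eps e0; have [N NP] := ul eps e0.
exists N => // n /= Nn; have /andP[a b] := NP n Nn.
have fn : u n \is a fin_num.
  by rewrite fin_real// (lt_le_trans _ a) ?ltNyr// (le_lt_trans b) ?ltry.
by move: a b; rewrite -(fineK fn) !lee_fin => a b; rewrite ler_distl; lra.
Qed.

(** The convergence of the suprema over [A], split into the bound for all
points and the existence of a good one, since the two are always proved and
used separately. *)
Definition sup_tends (T : Type) (A : set T) (f : nat -> T -> R) (l : R) :=
  forall eps : R, 0 < eps -> exists N, forall n, (N <= n)%N ->
    (forall p, A p -> f n p <= l + eps) /\ exists2 p, A p & l - eps <= f n p.

Lemma ereal_sup_cvgP (T : Type) (A : set T) (f : nat -> T -> R) (l : R) :
  A !=set0 ->
  ereal_sup [set (f n p)%:E | p in A] @[n --> \oo] --> l%:E <->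
  sup_tends A f l.
Proof.
move=> A0; split=> [/ereal_cvg_approx fl eps e0|fl].
  have e20 : 0 < eps / 2 by rewrite divr_gt0.
  have [N NP] := fl _ e20; exists N => n Nn; have /andP[a b] := NP n Nn; split.
    move=> p Ap; rewrite -lee_fin; apply: (@le_trans _ _ (l + eps / 2)%:E).
      by apply: le_trans b; apply: ereal_sup_ubound; exists p.
    by rewrite lee_fin; lra.
  have : ((l - eps)%:E < ereal_sup [set (f n p)%:E | p in A])%E.
    by apply: lt_le_trans a; rewrite lte_fin; lra.
  by move=> /ereal_sup_gt[_ [p Ap <-] /ltW lp]; exists p.
apply/ereal_cvg_approx => eps e0; have [N NP] := fl eps e0.
exists N => n Nn; have [ub [p Ap lb]] := NP n Nn; apply/andP; split.
  by apply: (@le_trans _ _ (f n p)%:E) => //; apply: ereal_sup_ubound; exists p.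
by apply: ge_ereal_sup => _ [q Aq <-]; rewrite lee_fin; exact: ub.
Qed.

(** The first term follows the first law; as products exist, every law of [P1]
arises in this way, so the conditions on the first term are conditions on
[P0]. *)
Lemma iid_marginal (P1 : set (probability R R)) (P : probability (RN R) R) :
  iid_probs P1 P -> exists2 Q, P1 Q &
    forall B, measurable B -> P (@canon_rv R 0 @^-1` B) = Q B.
Proof.
move=> [mu1 [kappa [P1mu _ PE]]]; exists mu1 => // B mB.
have mA : measurable [set t : 1.-tuple R | B (tnth t ord0)].
  by rewrite -[X in measurable X]setTI; exact: measurable_tnth.
have := PE 0 _ mA; rewrite /= (_ : [set w | _] = @canon_rv R 0 @^-1` B).
  by move=> ->; rewrite -[X in mu1 X]setIT -integral_indic.
by apply/seteqP; split => w /=; rewrite tnth_mktuple.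
Qed.

Lemma iid_marginal_surj (P1 : set (probability R R)) Q : P1 Q ->
  exists2 P, iid_probs P1 P &
    forall B, measurable B -> P (@canon_rv R 0 @^-1` B) = Q B.
Proof.
move=> P1Q; have [P iidP] := iid_product_probs Q.
have [Q' -> PQ] := iid_marginal iidP; exists P => //.
have [mu1 [kappa [Qmu kap PE]]] := iidP; exists mu1, kappa; split => //.
  by rewrite Qmu.
by move=> n; have [mk kQ] := kap n; split => // x; rewrite kQ.
Qed.

Lemma sublin_exp_canon0 (P0 : set (probability R R)) (g : R -> R) : bmfun g ->
  sublin_exp (iid_probs P0) (fun w => g (canon_rv 0 w)) =
  ereal_sup [set (\int[Q]_y g y)%:E | Q in P0].
Proof.
move=> bg; have EE (P : probability (RN R) R) (Q : probability R R) :
    (forall B, measurable B -> P (@canon_rv R 0 @^-1` B) = Q B) ->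
    'E_P[fun w => g (canon_rv 0 w)]%E = (\int[Q]_y g y)%:E.
  move=> PQ; rewrite unlock -bmfun_integralE//.
  pose X := mfun_Sub (mem_set (@measurable_canon_rv R 0)) : {mfun RN R >-> R}.
  transitivity (\int[distribution P X]_y (g y)%:E)%E; last first.
    by apply: eq_measure_integral => A mA _; exact: PQ.
  rewrite integral_distribution//.
    by apply/measurable_EFinP; case: bg.
  apply: (@bmfun_integrable _ _ _ P (g \o @canon_rv R 0)).
  split; last by have [_ [B gB]] := bg; exists B => w; exact: gB.
  by apply: measurableT_comp; [case: bg|exact: measurable_canon_rv].
congr ereal_sup; apply/seteqP; split => _ [P0P iidP <-].
  by have [Q P0Q PQ] := iid_marginal iidP; exists Q => //; rewrite (EE _ Q).
by have [P iP PQ] := iid_marginal_surj iidP; exists P => //; rewrite (EE _ P0P).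
Qed.

Lemma upper_cap_canon0 (P0 : set (probability R R)) (t : R) :
  upper_cap (iid_probs P0) [set w | t <= `|canon_rv 0 w|] =
  ereal_sup [set (ptail Q t)%:E | Q in P0].
Proof.
have mA := measurable_norm_ge t.
congr ereal_sup; apply/seteqP; split => _ [Q P0Q <-].
  have [Q' P0Q' PQ] := iid_marginal P0Q; exists Q' => //.
  by rewrite /ptail fineK ?fin_num_measure// -(PQ _ mA).
have [P iP PQ] := iid_marginal_surj P0Q; exists P => //.
by rewrite /ptail fineK ?fin_num_measure// -(PQ _ mA).
Qed.

Lemma tail_cvgP (P0 : set (probability R R)) : P0 !=set0 ->
  (n%:R%:E * upper_cap (iid_probs P0) [set w | (n%:R <= `|canon_rv 0 w|)%R])%E
    @[n --> \oo] --> 0%:E <->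
  tails_vanish P0.
Proof.
move=> [Q0 P0Q0]; under eq_fun do rewrite upper_cap_canon0.
have sup0 n : (0 <= ereal_sup [set (ptail Q n%:R)%:E | Q in P0])%E.
  apply: (@le_trans _ _ (ptail Q0 n%:R)%:E); first by rewrite lee_fin ptail_ge0.
  by apply: ereal_sup_ubound; exists Q0.
split=> [/ereal_cvg_approx U eps e0|U].
  have [N NP] := U eps e0; exists N => n Q Nn P0Q.
  have /andP[_] := NP n Nn; rewrite add0r => nU.
  rewrite -lee_fin EFinM; apply: le_trans nU.
  by rewrite lee_wpmul2l ?lee_fin// ereal_sup_ubound//; exists Q.
apply/ereal_cvg_approx => eps e0; have [N NP] := U eps e0.
exists (maxn N 1) => n; rewrite geq_max => /andP[Nn n0]; rewrite !add0r.
have nR0 : 0 < n%:R :> R by rewrite ltr0n.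
apply/andP; split.
  apply: (@le_trans _ _ 0%E); first by rewrite lee_fin; lra.
  by rewrite mule_ge0 ?lee_fin.
have -> : eps%:E = (n%:R%:E * (eps / n%:R)%:E)%E :> \bar R.
  by rewrite -EFinM mulrC divfK// gt_eqF.
rewrite lee_wpmul2l ?lee_fin//; apply: ge_ereal_sup => _ [Q P0Q <-].
by rewrite lee_fin ler_pdivlMr// mulrC NP.
Qed.

Lemma clip_cvgP (P0 : set (probability R R)) (m : R) : P0 !=set0 ->
  sublin_exp (iid_probs P0)
    (fun w => Num.min (Num.max (- n%:R) (canon_rv 0 w)) n%:R) @[n --> \oo]
    --> m%:E <->
  sup_tends P0 (fun n Q => \int[Q]_y clip n%:R y) m.
Proof.
move=> P00.
under eq_fun => n do rewrite (sublin_exp_canon0 P0 (bmfun_clip n%:R)).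
exact: ereal_sup_cvgP.
Qed.

End limits.

Section translation.
Context (R : realType) (P0 : set (probability R R)).
Hypothesis P00 : P0 !=set0.

Lemma sub_iid_probs (P1 : set (probability R R)) : P1 `<=` P0 ->
  iid_probs P1 `<=` iid_probs P0.
Proof.
move=> P10 P [mu1 [kappa [P1mu kap PE]]]; exists mu1, kappa; split => //.
  exact: P10.
by move=> n; have [mk kP] := kap n; split => // x; exact: P10.
Qed.

Lemma Rintegral_clipN (Q : probability R R) (n : nat) :
  \int[Q]_y clip n%:R (- y) = - \int[Q]_y clip n%:R y.
Proof.
rewrite -mulN1r -bmfun_intZ; last exact: bmfun_clip.
by apply: eq_Rintegral => y _; rewrite clipN// mulN1r.
Qed.

Lemma clipN_cvgP (m : R) :
  (- sublin_exp (iid_probs P0)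
       (fun w => Num.min (Num.max (- n%:R) (- canon_rv 0 w)) n%:R)%R)%E
     @[n --> \oo] --> m%:E <->
  sup_tends P0 (fun n Q => -1 * \int[Q]_y clip n%:R y) (- m).
Proof.
pose u n := sublin_exp (iid_probs P0)
  (fun w => Num.min (Num.max (- n%:R) (- canon_rv 0 w)) n%:R).
have bc n : bmfun (fun y : R => clip n%:R (- y)).
  split; last by exists `|n%:R| => y; exact: clip_norm.
  apply: measurableT_comp; first by case: (bmfun_clip (n%:R : R)).
  exact: measurable_funN.
have uE : u = fun n =>
    ereal_sup [set (-1 * \int[Q]_y clip n%:R y)%:E | Q in P0].
  apply/funext => n; rewrite /u (sublin_exp_canon0 P0 (bc n)).
  congr ereal_sup; apply: eq_imagel => Q _.
  by rewrite Rintegral_clipN mulN1r.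
transitivity (u @ \oo --> (- m)%:E).
  split; first by move=> /cvgeN; under eq_fun do rewrite oppeK.
  by move=> /cvgeN; rewrite -EFinN opprK.
rewrite uE; exact: ereal_sup_cvgP.
Qed.

Lemma Cb_bmfun (phi : R -> R) : Cb phi -> bmfun phi.
Proof.
move=> [cphi [M [_ phiM]]]; split; first exact: continuous_measurable_fun.
by exists (M + 1) => x; apply: phiM => //; rewrite ltrDl.
Qed.

Lemma bmfun_mean (phi : R -> R) n : bmfun phi ->
  bmfun (fun w : RN R => phi (psum id n w / n%:R)).
Proof.
move=> [mphi [B phiB]]; split; last by exists B.
apply: (measurableT_comp mphi); apply: measurable_funM => //.
exact: measurable_psum.
Qed.

Lemma iid_probs_nonempty : iid_probs P0 !=set0.
Proof.
have [Q P0Q] := P00; have [P iidP] := iid_product_probs Q.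
by exists P; apply: sub_iid_probs iidP => _ ->.
Qed.

Lemma mean_cvgP (phi : R -> R) (m : R) : Cb phi ->
  sublin_exp (iid_probs P0)
    (fun w => phi ((\sum_(i < n) canon_rv i w) / n%:R)) @[n --> \oo]
    --> m%:E <->
  sup_tends (iid_probs P0) (fun n P => \int[P]_w phi (psum id n w / n%:R)) m.
Proof.
move=> Cphi; rewrite -(ereal_sup_cvgP _ _ iid_probs_nonempty).
rewrite (_ : (fun n => _) = fun n => ereal_sup
  [set (\int[P]_w phi (psum id n w / n%:R))%:E | P in iid_probs P0])//.
apply/funext => n; congr ereal_sup; apply: eq_imagel => P _.
by rewrite unlock -bmfun_integralE//; exact/bmfun_mean/Cb_bmfun.
Qed.

End translation.

(** * Sufficiency *)

Section sufficiency.
Context (R : realType).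

(** A constant is added to [g] to reduce to a nonnegative function, for which
integrals are additive in the measure. *)
Lemma Rintegral_mixture (P Q S : probability R R) (t : R) (g : R -> R) :
  0 <= t <= 1 ->
  (forall A, measurable A -> S A = (t%:E * P A + (1 - t)%:E * Q A)%E) ->
  bmfun g -> \int[S]_y g y = t * \int[P]_y g y + (1 - t) * \int[Q]_y g y.
Proof.
move=> /andP[t0 t1] SE bg; have [mg [B gB]] := bg.
have t1' : 0 <= 1 - t by rewrite subr_ge0.
have bgB : bmfun (fun y => g y + B) by exact: bmfunD.
have g0 y : (0 <= (g y + B)%:E)%E.
  by rewrite lee_fin; have := gB y; rewrite ler_norml; lra.
have mgB : measurable_fun [set: R] (fun y => (g y + B)%:E).
  by apply/measurable_EFinP; case: bgB.
have shift (T : probability R R) : \int[T]_y (g y + B) = \int[T]_y g y + B.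
  by rewrite bmfun_intD// Rintegral_prob_cst.
suff : \int[S]_y (g y + B) =
    t * \int[P]_y (g y + B) + (1 - t) * \int[Q]_y (g y + B).
  by rewrite !shift; lra.
apply: EFin_inj; rewrite -bmfun_integralE// EFinD !EFinM -!bmfun_integralE//.
transitivity (\int[measure_add (mscale (NngNum t0) P) (mscale (NngNum t1') Q)]_y
    (g y + B)%:E)%E.
  apply: eq_measure_integral => A mA _.
  by rewrite /= /msum !big_ord_recl big_ord0 adde0; exact: SE.
rewrite [LHS]ge0_integral_measure_add//.
by rewrite !ge0_integral_mscale.
Qed.

(** The mean leaves [[lo, hi]] on two events of probability at most [e], where
[phi] exceeds [M] by at most [2 * B]. *)
Lemma mean_le (P : probability (RN R) R) (phi : R -> R) (B M lo hi e : R) n :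
  (0 < n)%N -> bmfun phi -> (forall x, `|phi x| <= B) -> - B <= M ->
  (forall x, lo <= x <= hi -> phi x <= M) ->
  fine (P [set w | n%:R * hi <= 1 * psum id n w]) <= e ->
  fine (P [set w | n%:R * (- lo) <= -1 * psum id n w]) <= e ->
  \int[P]_w phi (psum id n w / n%:R) <= M + 4 * B * e.
Proof.
move=> n0 bphi phiB BM phiM.
set U := [set w | _]; set D := [set w | _] => Ue De.
have mp s : measurable_fun [set: RN R] (fun w => s * psum id n w).
  by apply: measurable_funM => //; exact: measurable_psum.
have mU : measurable U by exact: measurable_ge.
have mD : measurable D by exact: measurable_ge.
have B0 : 0 <= B by apply: le_trans (phiB 0).
have nR0 : 0 < n%:R :> R by rewrite ltr0n.
have bUD : bmfun (fun w => \1_U w + \1_D w : R).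
  by apply: bmfunD; exact: bmfun_indic.
apply: (@le_trans _ _ (\int[P]_w (M + 2 * B * (\1_U w + \1_D w)))).
  apply: bmfun_le; first exact: bmfun_mean.
    by apply: bmfunD => //; exact: bmfunZ.
  move=> w.
  have ph : phi (psum id n w / n%:R) <= B.
    exact: le_trans (ler_norm _) (phiB _).
  have [Uw|nU] := pselect (U w).
    have : 0 <= \1_D w :> R by rewrite indicE.
    rewrite [\1_U w]indicE mem_set//= => d0.
    have : 0 <= B * \1_D w by exact: mulr_ge0.
    by rewrite mulrDr -mulrA; lra.
  have [Dw|nD] := pselect (D w).
    have : 0 <= \1_U w :> R by rewrite indicE.
    rewrite [\1_D w]indicE mem_set//= => d0.
    have : 0 <= B * \1_U w by exact: mulr_ge0.
    by rewrite mulrDr -(mulrA 2 B (\1_U w)); lra.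
  rewrite !indicE !memNset// addr0 mulr0 addr0; apply: phiM.
  move: nU nD; rewrite /U /D /= mul1r mulN1r => /negP + /negP.
  rewrite -!ltNge => a b; rewrite ler_pdivlMr// ler_pdivrMr//; lra.
rewrite bmfun_intD//; last exact: bmfunZ.
rewrite bmfun_intZ// Rintegral_prob_cst bmfun_intD; [|exact: bmfun_indic..].
rewrite !Rintegral_prob_indic// lerD2l.
rewrite (_ : 4 * B * e = 2 * B * (e + e)); last by lra.
by rewrite ler_wpM2l ?mulr_ge0 ?lerD.
Qed.

Lemma continuous_ball (phi : R -> R) (x e : R) : continuous phi -> 0 < e ->
  exists2 d, 0 < d & forall y, `|y - x| <= d -> `|phi y - phi x| <= e.
Proof.
move=> cphi e0; have /cvgrPdist_le/(_ e e0) := cphi x.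
move=> /nbhs_ballP[d /= d0 dP]; exists (d / 2); first by rewrite divr_gt0.
move=> y yx; rewrite distrC; apply: dP; rewrite /ball/= distrC.
by apply: le_lt_trans yx _; lra.
Qed.

Lemma near_interval_le (phi : R -> R) (a b M e : R) : continuous phi ->
  a <= b -> (forall x, a <= x <= b -> phi x <= M) -> 0 < e ->
  exists2 h, 0 < h &
    forall x, - (- a + h + h) <= x <= b + h + h -> phi x <= M + e.
Proof.
move=> cphi ab phiM e0.
have [d1 d10 hd1] := continuous_ball a cphi e0.
have [d2 d20 hd2] := continuous_ball b cphi e0.
have Ma := phiM a; have Mb := phiM b.
exists (Num.min (d1 / 2) (d2 / 2)); first by rewrite lt_min !divr_gt0.
set h := Num.min _ _ => x.
have h1 : h <= d1 / 2 by rewrite /h ge_min lexx.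
have h2 : h <= d2 / 2 by rewrite /h ge_min lexx orbT.
clearbody h; have [xa|ax] := ltP x a.
  move=> xI; have /hd1 : `|x - a| <= d1 by rewrite ler_distl; lra.
  by rewrite ler_distl; lra.
have [xb|bx] := leP x b; first by have := phiM x; lra.
move=> xI; have /hd2 : `|x - b| <= d2 by rewrite ler_distl; lra.
by rewrite ler_distl; lra.
Qed.

Context (P0 : set (probability R R)).

(** If the truncated means lie in a slight enlargement of [[a, b]], then the
mean asymptotically does, and [phi] is at most about [M] there. *)
Lemma unif_mean_le (phi : R -> R) (a b M eps : R) : tails_vanish P0 ->
  Cb phi -> a <= b -> (forall x, a <= x <= b -> phi x <= M) -> 0 < eps ->
  exists2 h, 0 < h & exists N, forall n, (N <= n)%N ->
    forall P1 P, P1 `<=` P0 -> iid_probs P1 P ->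
      (forall Q, P1 Q -> 1 * \int[Q]_y clip n%:R y <= b + h) ->
      (forall Q, P1 Q -> -1 * \int[Q]_y clip n%:R y <= - a + h) ->
      \int[P]_w phi (psum id n w / n%:R) <= M + eps.
Proof.
move=> tails Cphi ab phiM e0.
have e20 : 0 < eps / 2 by rewrite divr_gt0.
have [h h0 hM] := near_interval_le Cphi.1 ab phiM e20.
have bphi := Cb_bmfun Cphi; have [_ [B phiB]] := bphi.
have B0 : 0 <= B by apply: le_trans (phiB 0).
have BM : - B <= M + eps / 2.
  have := phiM a; have := phiB a; rewrite lexx ab ler_norml.
  by move=> /andP[? _] /(_ isT); lra.
(* An exceptional probability of [e] on each side costs [4 * B * e]. *)
have [e ee Be] : exists2 e, 0 < e & 4 * B * e <= eps / 2.
  exists (eps / (8 * (B + 1))); first by rewrite divr_gt0// mulr_gt0//; lra.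
  rewrite mulrA ler_pdivrMr; last by lra.
  rewrite (_ : eps / 2 * _ = 4 * (B + 1) * eps); last by lra.
  by rewrite ler_wpM2r//; lra.
have [N ut] := unif_tail tails (`|a| + `|b| + h) h0 ee.
exists h => //; exists N => n /ut[n0 {}ut] P1 P P10 iidP up low.
have C x : `|x| <= `|a| + `|b| -> `|x + h| <= `|a| + `|b| + h.
  by move=> xC; rewrite (le_trans (ler_normD _ _))// (gtr0_norm h0) lerD2r.
apply: (@le_trans _ _ ((M + eps / 2) + 4 * B * e)); last first.
  by rewrite -addrA lerD2l [leRHS]splitr lerD2l.
apply: (mean_le n0 bphi phiB BM hM).
  by apply: (ut P1) => //; [rewrite normr1|apply: C; rewrite lerDr].
rewrite opprK; apply: (ut P1) => //; first by rewrite normrN1.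
by apply: C; rewrite normrN lerDl.
Qed.

Context (mulo muhi : R).
Hypothesis P0_convex : convex_probs P0.
Hypothesis mulohi : mulo <= muhi.
Hypothesis tails : tails_vanish P0.
Hypothesis upper :
  sup_tends P0 (fun n Q => \int[Q]_y clip n%:R y) muhi.
Hypothesis lower :
  sup_tends P0 (fun n Q => -1 * \int[Q]_y clip n%:R y) (- mulo).

(** By convexity, every mean between the extreme ones is nearly attained. *)
Lemma mean_attained (mu e : R) : mulo <= mu <= muhi -> 0 < e ->
  exists N, forall n, (N <= n)%N -> exists2 Q, P0 Q &
    1 * \int[Q]_y clip n%:R y <= mu + e /\
    -1 * \int[Q]_y clip n%:R y <= - mu + e.
Proof.
move=> /andP[lomu muhi'] e0.
have [N1 up] := upper e0; have [N2 low] := lower e0.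
exists (maxn N1 N2) => n; rewrite geq_max.
move=> /andP[/up[_ [Q1 P0Q1]] + /low[_ [Q2 P0Q2]]].
set b1 := \int[Q1]_y _; set b2 := \int[Q2]_y _ => h1 h2.
have [b1mu|mub1] := leP b1 mu.
  by exists Q1 => //; rewrite -/b1; split; lra.
have [mub2|b2mu] := leP mu b2.
  by exists Q2 => //; rewrite -/b2; split; lra.
pose t := (mu - b2) / (b1 - b2).
have b12 : 0 < b1 - b2 by lra.
have t01 : 0 <= t <= 1 by rewrite divr_ge0 ?ler_pdivrMr//; lra.
have [S P0S SE] := P0_convex P0Q1 P0Q2 t01.
exists S => //; rewrite (Rintegral_mixture t01 SE (bmfun_clip _)) -/b1 -/b2.
rewrite (_ : t * b1 + (1 - t) * b2 = mu); first by split; lra.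
by rewrite /t; field; rewrite gt_eqF.
Qed.

(** The upper bound concerns all laws of the family and the whole interval. The
lower bound is an upper bound for [- phi], for independent copies of a law whose
truncated mean is near a point where [phi] is maximal. *)
Lemma mean_limit (phi : R -> R) (m : R) : Cb phi ->
  is_maximum (phi @` `[mulo, muhi]) m ->
  sup_tends (iid_probs P0) (fun n P => \int[P]_w phi (psum id n w / n%:R)) m.
Proof.
move=> Cphi [[mu muI <-] mub] eps e0.
have mubI x : mulo <= x <= muhi -> phi x <= phi mu.
  by move=> xI; apply: mub; exists x => //; rewrite /= in_itv.
have {}muI : mulo <= mu <= muhi by move: muI; rewrite /= in_itv.
have CN : Cb (fun x => - phi x).
  split; first by move=> x; apply: cvgN; exact: Cphi.1.
  have [_ [M [Mr phiM]]] := Cphi.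
  by exists M; split => // B MB x _; rewrite /= normrN; exact: phiM.
have muN x : mu <= x <= mu -> - phi x <= - phi mu.
  by move=> xmu; rewrite (@le_anti _ _ x mu)// andbC.
have [h1 h10 [N1 le1]] := unif_mean_le tails Cphi mulohi mubI e0.
have [h2 h20 [N2 le2]] := unif_mean_le tails CN (lexx mu) muN e0.
have [N3 up] := upper h10; have [N4 low] := lower h10.
have [N5 att] := mean_attained muI h20.
exists (maxn (maxn N1 N2) (maxn (maxn N3 N4) N5)) => n; rewrite !geq_max.
move=> /andP[/andP[Nn1 Nn2] /andP[/andP[/up[upn _] /low[lown _]]]].
move=> /att[Q P0Q [Qup Qlow]]; split=> [P iidP|].
  by apply: (le1 n Nn1 P0 P) => // Q' /upn; rewrite mul1r.
have [P iidP] := iid_product_probs Q.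
have Q0 : [set Q] `<=` P0 by move=> _ ->.
exists P; first exact: sub_iid_probs iidP.
have := le2 n Nn2 _ P Q0 iidP; set I := \int[P]_w _ => H.
have {}H : I <= - phi mu + eps by apply: H => _ ->.
have : I = - \int[P]_w phi (psum id n w / n%:R).
  rewrite -mulN1r -bmfun_intZ; last exact/bmfun_mean/Cb_bmfun.
  by apply: eq_Rintegral => w _; rewrite mulN1r.
by move=> IE; move: H; rewrite IE addrC -opprB lerN2.
Qed.

End sufficiency.

(** * Small tails from concentration *)

(** An operator on functions of the starting point, so that the Markov property
becomes a composition of operators. *)
Definition walk (R : realType) (P : probability (RN R) R) (k : nat) (F : R -> R)
  (s : R) : R := \int[P]_w F (s + psum id k w).

Definition mfun01 (R : realType) (F : R -> R) :=
  measurable_fun [set: R] F /\ forall x, 0 <= F x <= 1.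

Section walk.
Context (R : realType) (Q : probability R R) (P : probability (RN R) R).
Hypothesis iidP : iid_probs [set Q] P.
Implicit Types (F G : R -> R) (s t : R).

Lemma mfun01_bmfun F : mfun01 F -> bmfun F.
Proof.
move=> [mF F01]; split => //; exists 1 => x.
by have /andP[F0 F1] := F01 x; rewrite ger0_norm.
Qed.

Lemma bmfun_walk k F s : mfun01 F -> bmfun (fun w => F (s + psum id k w)).
Proof.
move=> bF; have [mF F01] := bF; have [_ [B FB]] := mfun01_bmfun bF.
split; last by exists B.
apply: (measurableT_comp mF); apply: measurable_funD => //.
exact: measurable_psum.
Qed.

Definition smear F (s : R) : R := \int[Q]_y F (s + y).

Lemma mfun01_shift F (s : R) : mfun01 F -> bmfun (fun y : R => F (s + y)).
Proof.
move=> bF; have [mF F01] := bF; have [_ [B FB]] := mfun01_bmfun bF.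
split; last by exists B.
by apply: (measurableT_comp mF); exact: measurable_funD.
Qed.

Lemma mfun01_smear F : mfun01 F -> mfun01 (smear F).
Proof.
move=> bF; have [mF F01] := bF; split.
  have mF2 : measurable_fun [set: R * R] (fun z => (F (z.1 + z.2))%:E).
    apply/measurable_EFinP; apply: (measurableT_comp mF).
    exact: measurable_funD.
  have F0 (z : R * R) : (0 <= (F (z.1 + z.2))%:E)%E.
    by rewrite lee_fin; have /andP[] := F01 (z.1 + z.2).
  have := measurable_fun_fubini_tonelli_F (m2 := Q) _ mF2 F0.
  rewrite (_ : fubini_F _ _ = EFin \o smear F); first by move/measurable_EFinP.
  apply/funext => s /=; rewrite /fubini_F /=.
  by rewrite -bmfun_integralE//; exact: mfun01_shift.
move=> s; apply/andP; split.
  by apply: Rintegral_ge0 => y _; have /andP[] := F01 (s + y).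
rewrite -[leRHS](Rintegral_prob_cst Q); apply: bmfun_le => //.
  exact: mfun01_shift.
by move=> y; have /andP[] := F01 (s + y).
Qed.

Lemma walk0 F s : walk P 0 F s = F s.
Proof.
rewrite /walk -[RHS](Rintegral_prob_cst P); apply: eq_Rintegral => w _.
by rewrite /psum big_ord0 addr0.
Qed.

Lemma walkS k F s : mfun01 F -> walk P k.+1 F s = walk P k (smear F) s.
Proof.
move=> bF; have [mF F01] := bF.
have [K [KQ KE]] := iid_probs_cond iidP k.
pose G (z : R * R) := (F (s + (z.1 + z.2)))%:E.
have mG : measurable_fun [set: R * R] G.
  apply/measurable_EFinP; apply: (measurableT_comp mF).
  by apply: measurable_funD => //; exact: measurable_funD.
have G0 z : (0 <= G z)%E.
  by rewrite lee_fin; have /andP[] := F01 (s + (z.1 + z.2)).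
have [_ {}KE] := KE id G (@measurable_id _ _ _) mG G0.
apply: EFin_inj; rewrite -bmfun_integralE; last exact: bmfun_walk.
rewrite -bmfun_integralE; last by apply: bmfun_walk; exact: mfun01_smear.
transitivity (\int[P]_w G (psum id k w, canon_rv k w))%E.
  by apply: eq_integral => w _; rewrite /G psumS.
rewrite KE; apply: eq_integral => w _; rewrite KQ /smear -bmfun_integralE.
  by apply: eq_integral => y _; rewrite /G addrA.
exact: mfun01_shift.
Qed.

Lemma mfun01_walk k F : mfun01 F -> mfun01 (walk P k F).
Proof.
elim: k F => [|k IH] F bF.
  by rewrite (_ : walk P 0 F = F)//; apply/funext => s; rewrite walk0.
rewrite (_ : walk P k.+1 F = walk P k (smear F)); first exact/IH/mfun01_smear.
by apply/funext => s; rewrite walkS.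
Qed.

Lemma walkD j k F s : mfun01 F -> walk P (k + j) F s = walk P k (walk P j F) s.
Proof.
elim: j F s => [|j IH] F s bF.
  by rewrite addn0; congr (walk P k _ s); apply/funext => t; rewrite walk0.
rewrite addnS walkS// IH; last exact: mfun01_smear.
by congr (walk P k _ s); apply/funext => t; rewrite walkS.
Qed.

Lemma walkSl k F s : mfun01 F -> walk P k.+1 F s = \int[Q]_y walk P k F (s + y).
Proof.
by move=> bF; rewrite -add1n walkD// walkS ?walk0//; exact: mfun01_walk.
Qed.

Lemma walk_le k F G s t : mfun01 F -> mfun01 G ->
  (forall x, F (s + x) <= G (t + x)) -> walk P k F s <= walk P k G t.
Proof. by move=> bF bG FG; apply: bmfun_le => //; exact: bmfun_walk. Qed.

Definition far (a x : R) : R := \1_[set x | a < `|x|] x.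
Definition near0 (a x : R) : R := \1_[set x | `|x| <= a] x.

Lemma near0E a x : near0 a x = 1 - far a x.
Proof.
rewrite /near0 /far !indicE; case: (leP `|x| a) => xa.
  by rewrite mem_set// memNset/= ?subr0//; apply/negP; rewrite -leNgt.
by rewrite memNset ?mem_set/= ?subrr//; apply/negP; rewrite -ltNge.
Qed.

Lemma far1 a x : a < `|x| -> far a x = 1.
Proof. by move=> ax; rewrite /far indicE mem_set. Qed.

Lemma far0 a x : `|x| <= a -> far a x = 0.
Proof.
by move=> xa; rewrite /far indicE memNset//=; apply/negP; rewrite -leNgt.
Qed.

Lemma far01 a x : 0 <= far a x <= 1.
Proof. by rewrite /far indicE; case: (_ \in _); rewrite /= ?lexx ?ler01. Qed.

Lemma mfun01_far a : mfun01 (far a).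
Proof.
split; last exact: far01; apply: measurable_indic.
rewrite -[X in measurable X]setTI.
have -> : [set y : R | a < `|y|] = Num.norm @^-1` [set` `]a, +oo[%R].
  by apply/seteqP; split => x /=; rewrite in_itv/= andbT.
exact: normr_measurable.
Qed.

Lemma mfun01_near0 a : mfun01 (near0 a).
Proof.
split.
  rewrite (_ : near0 a = fun x => 1 - far a x); last first.
    by apply/funext => x; rewrite near0E.
  by apply: measurable_funB => //; case: (mfun01_far a).
by move=> x; rewrite near0E; have := far01 a x; lra.
Qed.

Lemma walk_near0 k a s : walk P k (near0 a) s = 1 - walk P k (far a) s.
Proof.
have bf := bmfun_walk k s (mfun01_far a).
rewrite /walk -[X in X - _](Rintegral_prob_cst P) -mulN1r -bmfun_intZ//.
rewrite -bmfun_intD//; last exact: bmfunZ.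
by apply: eq_Rintegral => w _; rewrite near0E mulN1r.
Qed.

(** A walk that is at distance more than [2 a] at time [k] is likely to be at
distance more than [a] still at time [k + n], since its next [n] steps sum to at
most [a] with probability at least one half. *)
Lemma walk_far_early (a eta : R) (n k : nat) : eta <= 2^-1 ->
  (forall j, (n <= j <= n + n)%N -> walk P j (far a) 0 <= eta) ->
  (k <= n)%N -> walk P k (far (2 * a)) 0 <= 2 * eta.
Proof.
move=> e2 far_n kn.
have bn := mfun01_walk n (mfun01_far a).
have half x : 2^-1 * far (2 * a) x <= walk P n (far a) x.
  have [xa|ax] := leP `|x| (2 * a).
    by rewrite far0// mulr0; have [_ /(_ x)/andP[]] := bn.
  rewrite far1// mulr1; apply: (@le_trans _ _ (walk P n (near0 a) 0)).
    rewrite walk_near0; have := far_n n.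
    by rewrite leqnn leq_addr => /(_ isT); lra.
  apply: walk_le; [exact: mfun01_near0|exact: mfun01_far|move=> y].
  rewrite add0r near0E; have [ya|ay] := leP `|y| a.
    rewrite far0// subr0 far1//; have := ler_normB (x + y) y.
    by rewrite addrK; lra.
  by rewrite far1// subrr; have /andP[] := far01 a (x + y).
have : 2^-1 * walk P k (far (2 * a)) 0 <= walk P (k + n) (far a) 0.
  rewrite walkD; last exact: mfun01_far.
  rewrite /walk -bmfun_intZ; last exact: bmfun_walk (mfun01_far _).
  apply: bmfun_le; [by apply: bmfunZ; exact: bmfun_walk (mfun01_far _)|
    exact: bmfun_walk bn|by move=> w; exact: half].
by have := far_n (k + n)%N; rewrite leq_addl leq_add2r kn => /(_ isT); lra.
Qed.

(** A jump longer than [5 A] from within [2 A] of the origin takes the walk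
further than [2 A] away, and from there it is unlikely to come back in the
remaining steps. So each step loses the probability of such a jump. *)
Lemma walk_near0_le (A tau : R) (n k : nat) : 0 < A -> 0 <= tau ->
  (forall j, (j <= n)%N -> walk P j (far A) 0 <= tau) -> (k <= n)%N ->
  forall s, walk P k (near0 A) s <= tau + (1 - ptail Q (5 * A)) ^+ k.
Proof.
move=> A0 t0 far_n; set u := ptail Q (5 * A).
have mA := measurable_norm_ge (5 * A).
have u1 : u <= 1 by exact: prob_le1.
have away j s : (j <= n)%N -> 2 * A < `|s| -> walk P j (near0 A) s <= tau.
  move=> jn As; apply: le_trans (far_n j jn).
  apply: walk_le; [exact: mfun01_near0|exact: mfun01_far|move=> y].
  rewrite add0r near0E; have [yA|Ay] := leP `|y| A.
    rewrite (far0 yA) (@far1 A (s + y)) ?subrr//.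
    by have := ler_normB (s + y) y; rewrite addrK; lra.
  by rewrite (far1 Ay); have := far01 A (s + y); lra.
elim: k => [|k IH] kn s.
  by rewrite expr0 walk0; have [_ /(_ s)/andP[_ ]] := mfun01_near0 A; lra.
have up0 i : 0 <= (1 - u) ^+ i by rewrite exprn_ge0// subr_ge0.
have [sA|As] := leP `|s| (2 * A); last first.
  by apply: le_trans (away _ _ kn As) _; rewrite lerDl.
rewrite walkSl; last exact: mfun01_near0.
pose J := [set y : R | 5 * A <= `|y|].
have bJ : bmfun (\1_J : R -> R) by exact: bmfun_indic.
apply: (@le_trans _ _
  (\int[Q]_y (tau + (1 - u) ^+ k + - (1 - u) ^+ k * \1_J y))).
  apply: bmfun_le.
  - exact: mfun01_shift (mfun01_walk k (mfun01_near0 A)).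
  - by apply: bmfunD => //; exact: bmfunZ.
  move=> y; rewrite indicE; have [Jy|nJy] := pselect (J y).
    rewrite mem_set// mulr1 addrK; apply: away; first exact: ltnW.
    have := ler_normB (s + y) s; rewrite addrAC subrr add0r.
    by move: Jy; rewrite /J/=; lra.
  by rewrite memNset// mulr0 addr0; apply: IH; exact: ltnW.
rewrite bmfun_intD//; last exact: bmfunZ.
rewrite bmfun_intZ// !Rintegral_prob_cst Rintegral_prob_indic// -/u.
rewrite (_ : fine _ = u)// exprS.
by rewrite -addrA lerD2l; lra.
Qed.

(** With [u] the probability of a long jump, concentration and the previous
lemma give [1 - 4 eta <= (1 - u)^n], while [(1 - u)^n (1 + n u) <= 1] by
Bernoulli's inequality for [(1 + u)^n]. *)
Lemma ptail_le_concentrated (a eta : R) (n : nat) : 0 < a -> 0 <= eta ->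
  eta <= 8^-1 ->
  (forall j, (n <= j <= n + n)%N -> walk P j (far a) 0 <= eta) ->
  n%:R * ptail Q (10 * a) <= 8 * eta.
Proof.
move=> a0 eta0 e8 far_n; have e2 : eta <= 2^-1 by lra.
have early k := walk_far_early e2 far_n (k := k).
have A0 : 0 < 2 * a by lra.
have t0 : 0 <= 2 * eta by lra.
have := walk_near0_le A0 t0 early (leqnn n) 0.
rewrite walk_near0 (_ : 5 * (2 * a) = 10 * a); last by lra.
set u := ptail Q (10 * a); have := early n (leqnn n).
have u0 : 0 <= u by exact: ptail_ge0.
have u1 : u <= 1 by apply: prob_le1; exact: measurable_norm_ge.
have bern : 1 + n%:R * u <= (1 + u) ^+ n.
  elim: n {far_n early} => [|m IH]; first by rewrite mul0r addr0 expr0.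
  have : 0 <= m%:R :> R by [].
  by rewrite exprS -natr1 => m0; nra.
have : (1 - u) ^+ n * (1 + u) ^+ n <= 1.
  by rewrite -exprMn exprn_ile1//; nra.
have : 0 <= (1 - u) ^+ n by rewrite exprn_ge0//; lra.
have nu0 : 0 <= n%:R * u by rewrite mulr_ge0.
move: bern nu0; set p := (1 - u) ^+ n; set q := (1 + u) ^+ n; set z := n%:R * u.
set W := walk _ _ _ _ => qz z0 p0 pq W1 W2.
have p1 : 1 - 4 * eta <= p by lra.
have : (1 - 4 * eta) * (1 + z) <= 1.
  by apply: le_trans pq; apply: ler_pM => //; lra.
nra.
Qed.

End walk.

(** * Necessity *)

(** The bounded continuous test functions that detect a mean beyond an end of
an interval: the upper one for [s = 1] and the lower one for [s = -1]. *)
Definition ramp (R : realType) (s c d x : R) : R :=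
  Num.min (Num.max 0 ((s * x - c) / d)) 1.

Section ramp.
Context (R : realType).
Implicit Types s c d x : R.

Lemma ramp01 s c d x : 0 <= ramp s c d x <= 1.
Proof.
by rewrite /ramp ge_min lexx orbT le_min le_max lexx ler01.
Qed.

Lemma ramp0 s c d x : 0 < d -> s * x <= c -> ramp s c d x = 0.
Proof.
move=> d0 sx; rewrite /ramp max_l ?min_l//.
by rewrite ler_pdivrMr// mul0r subr_le0.
Qed.

Lemma ramp1 s c d x : 0 < d -> c + d <= s * x -> ramp s c d x = 1.
Proof.
move=> d0 sx; rewrite /ramp min_r// le_max ler_pdivlMr// mul1r.
by apply/orP; right; lra.
Qed.

Lemma Cb_ramp s c d : Cb (ramp s c d).
Proof.
split; last first.
  exists 1; split; first exact: num_real.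
  move=> M M1 x _ /=; have /andP[a b] := ramp01 s c d x.
  by rewrite ger0_norm// (le_trans b)// ltW.
move=> x; apply: (@continuous_min R R (fun x => Num.max 0 ((s * x - c) / d))
    (fun=> 1)) => //; last exact: cvg_cst.
apply: (@continuous_max R R (fun=> 0) (fun x => (s * x - c) / d)) => //.
  exact: cvg_cst.
apply: cvgMl; apply: cvgB; last exact: cvg_cst.
by apply: cvgMr; exact: cvg_id.
Qed.

End ramp.

Section necessity.
Context (R : realType) (P0 : set (probability R R)) (mulo muhi : R).
Hypothesis limit : forall phi : R -> R, Cb phi ->
  exists2 m : R, is_maximum (phi @` `[mulo, muhi]) m &
  sup_tends (iid_probs P0) (fun n P => \int[P]_w phi (psum id n w / n%:R)) m.

(** A ramp that starts at the end of the interval has maximum 0 on it, so its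
worst expectation tends to 0, and it dominates the indicator of the event. *)
Lemma mean_concentrated (s c d eta : R) :
  (forall x, mulo <= x <= muhi -> s * x <= c) -> 0 < d -> 0 < eta ->
  exists N, forall n, (N <= n)%N -> (0 < n)%N /\ forall P, iid_probs P0 P ->
    fine (P [set w | n%:R * (c + d) <= s * psum id n w]) <= eta.
Proof.
move=> sc d0 eta0; have [m [[x xI <-] _]] := limit (Cb_ramp s c d).
rewrite ramp0//; last by apply: sc; move: xI; rewrite /= in_itv.
move=> /(_ _ eta0)[N NP]; exists (maxn N 1) => n.
rewrite geq_max => /andP[/NP[ub _] n0].
split => // P iidP; apply: le_trans (_ : 0 + eta <= _); last by rewrite add0r.
apply: le_trans (ub P iidP).
have nR0 : 0 < n%:R :> R by rewrite ltr0n.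
have mA : measurable [set w | n%:R * (c + d) <= s * psum id n w].
  by apply: measurable_ge; apply: measurable_funM => //; exact: measurable_psum.
rewrite -Rintegral_prob_indic//; apply: bmfun_le.
- exact: bmfun_indic.
- exact/bmfun_mean/Cb_bmfun/Cb_ramp.
move=> w; rewrite indicE.
have [Aw|nAw] := pselect ((n%:R * (c + d) <= s * psum id n w)).
  by rewrite ramp1 ?mem_set// mulrA ler_pdivlMr// mulrC.
by rewrite memNset//=; have /andP[] := ramp01 s c d (psum id n w / n%:R).
Qed.

Lemma ptail_anti (Q : probability R R) (a b : R) :
  a <= b -> ptail Q b <= ptail Q a.
Proof.
move=> ab; apply: prob_le; [exact: measurable_norm_ge..|].
by move=> y /=; exact: le_trans.
Qed.

(** The concentration of the mean bounds the sums at all times from [n] to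
[2 n] by [2 M n], hence [n P(|X| >= 20 M n)] tends to 0. This is the claim up to
the factor [20 M], which only changes the level of the tail. *)
Lemma tails_of_limit : tails_vanish P0.
Proof.
move=> eps eps0; pose M := `|mulo| + `|muhi| + 1.
have M1 : 1 <= M by rewrite lerDr addr_ge0.
pose L := (Num.bound (20 * M)).
have LM : 20 * M <= L%:R by apply/ltW/archi_boundP; lra.
have LR0 : 0 < L%:R :> R by apply: lt_le_trans LM; lra.
have L0 : (0 < L)%N by rewrite -(ltr0n R).
pose eta := Num.min 8^-1 (eps / (16 * L%:R)).
have eta0 : 0 < eta by rewrite lt_min invr_gt0 ltr0n divr_gt0// mulr_gt0.
have eta8 : eta <= 8^-1 by rewrite /eta ge_min lexx.
have etaL : 16 * L%:R * eta <= eps.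
  rewrite mulrC -ler_pdivlMr ?mulr_gt0//.
  by rewrite /eta ge_min lexx orbT.
have eta20 : 0 < eta / 2 by rewrite divr_gt0.
have hi x : mulo <= x <= muhi -> 1 * x <= muhi by rewrite mul1r => /andP[].
have lo x : mulo <= x <= muhi -> -1 * x <= - mulo.
  by rewrite mulN1r lerN2 => /andP[].
have [N1 N1P] := mean_concentrated hi ltr01 eta20.
have [N2 N2P] := mean_concentrated lo ltr01 eta20.
pose N := maxn N1 N2.
have conc n Q : (N <= n)%N -> P0 Q -> n%:R * ptail Q (20 * M * n%:R) <= 8 * eta.
  move=> Nn P0Q; have [P iidP] := iid_product_probs Q.
  have iidP0 : iid_probs P0 P by apply: sub_iid_probs iidP => _ ->.
  have [n0 _] := N1P n (leq_trans (leq_maxl _ _) Nn).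
  have nR0 : 0 < n%:R :> R by rewrite ltr0n.
  rewrite (_ : 20 * M * n%:R = 10 * (2 * M * n%:R)); last by lra.
  apply: (ptail_le_concentrated iidP) => //.
  - by rewrite !mulr_gt0//; lra.
  - exact: ltW.
  move=> j /andP[nj jn].
  have N1j : (N1 <= j)%N by exact: leq_trans (leq_trans (leq_maxl _ _) Nn) nj.
  have N2j : (N2 <= j)%N by exact: leq_trans (leq_trans (leq_maxr _ _) Nn) nj.
  have [j0 /(_ P iidP0) hij] := N1P j N1j.
  have [_ /(_ P iidP0) loj] := N2P j N2j.
  have mp s : measurable_fun [set: RN R] (fun w => s * psum id j w).
    by apply: measurable_funM => //; exact: measurable_psum.
  have mU := measurable_ge (j%:R * (muhi + 1)) (mp 1).
  have mD := measurable_ge (j%:R * (- mulo + 1)) (mp (-1)).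
  have -> : eta = eta / 2 + eta / 2 by lra.
  apply: le_trans (lerD hij loj).
  rewrite -!Rintegral_prob_indic// -bmfun_intD; [|exact: bmfun_indic..].
  apply: bmfun_le; [exact: (bmfun_walk j 0 (mfun01_far _))|
    by apply: bmfunD; exact: bmfun_indic|move=> w].
  rewrite add0r; have [wa|aw] := leP `|psum id j w| (2 * M * n%:R).
    by rewrite far0// !indicE addr_ge0.
  have jn2 : j%:R <= 2 * n%:R :> R.
    by rewrite -natrM ler_nat mul2n -addnn.
  have jR0 : 0 < j%:R :> R by rewrite ltr0n.
  have jM : j%:R * M <= 2 * M * n%:R by nra.
  have jlo : j%:R * (- mulo + 1) <= j%:R * M.
    rewrite ler_wpM2l//; have := ler_norm (- mulo); have := normr_ge0 muhi.
    by rewrite normrN /M; lra.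
  have jhi : j%:R * (muhi + 1) <= j%:R * M.
    rewrite ler_wpM2l//; have := ler_norm muhi; have := normr_ge0 mulo.
    by rewrite /M; lra.
  rewrite far1//; have := aw; rewrite ltr_normr => /orP[w0|w0].
    by rewrite indicE mem_set/= ?mul1r ?lerDl ?indicE//; lra.
  by rewrite [X in _ + X]indicE mem_set/= ?mulN1r ?lerDr ?indicE//; lra.
(* A level [r] lies between [L * n] and [2 * L * n]. *)
exists (L * N.+1)%N => r Q Nr P0Q.
pose n := (r %/ L)%N.
have nr : (n * L <= r)%N by exact: leq_divM.
have rn : (r <= 2 * n * L)%N.
  have n1 : (0 < n)%N by rewrite divn_gt0// (leq_trans _ Nr)// leq_pmulr.
  have := ltn_ceil r L0; rewrite -/n => /ltnW/leq_trans; apply.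
  by rewrite leq_mul2r mul2n -addnn -addn1 leq_add2l n1 orbT.
have Nn : (N <= n)%N.
  by rewrite leq_divRL// mulnC (leq_trans _ Nr)// leq_mul2l leqnSn orbT.
have := conc n Q Nn P0Q.
have rL : n%:R * L%:R <= r%:R :> R by rewrite -natrM ler_nat.
have nLM : 20 * M * n%:R <= n%:R * L%:R by rewrite mulrC ler_wpM2l.
have tr : ptail Q r%:R <= ptail Q (20 * M * n%:R).
  by apply: ptail_anti; exact: le_trans rL.
have rR : r%:R <= 2 * n%:R * L%:R :> R by rewrite -!natrM ler_nat.
have t0 := ptail_ge0 Q r%:R.
move=> h.
have : r%:R * ptail Q r%:R <= 2 * n%:R * L%:R * ptail Q (20 * M * n%:R).
  exact: ler_pM.
have : 2 * L%:R * (n%:R * ptail Q (20 * M * n%:R)) <= 2 * L%:R * (8 * eta).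
  by rewrite ler_wpM2l// mulr_ge0// ltW.
rewrite (_ : 2 * L%:R * (n%:R * _) =
  2 * n%:R * L%:R * ptail Q (20 * M * n%:R)); last by ring.
by rewrite (_ : 2 * L%:R * (8 * eta) = 16 * L%:R * eta); [lra|ring].
Qed.

(** If the truncated mean of some law exceeded [c], then by the classical weak
law independent copies of it would violate the concentration of the mean. If it
stayed below [c] for all laws, then so would the mean of any sequence by the
uniform weak law, against the limit for a ramp that ends at [c]. *)
Lemma clip_of_limit (s c x0 : R) : `|s| <= 1 ->
  (forall x, mulo <= x <= muhi -> s * x <= c) ->
  mulo <= x0 <= muhi -> s * x0 = c ->
  sup_tends P0 (fun n Q => s * \int[Q]_y clip n%:R y) c.
Proof.
move=> s1 sc x0I sx0 eps e0.
have e4 : 0 < eps / 4 by rewrite divr_gt0.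
have q4 : 0 < 4^-1 :> R by rewrite invr_gt0.
have [N1 conc] := mean_concentrated sc e4 q4.
have [N2 ut] := unif_tail tails_of_limit (`|c| + eps) e4 q4.
have [m [_ mub]] := limit (Cb_ramp s (c - eps / 2) (eps / 2)).
have m1 : 1 <= m.
  apply: mub; exists x0; first by rewrite /= in_itv.
  by rewrite ramp1//; lra.
move=> /(_ _ q4)[N3 att].
exists (maxn N1 (maxn N2 N3)) => n; rewrite !geq_max.
move=> /and3P[/conc[_ concn] /ut[n0 utn] /att[_ [P iidP lb]]].
have nR0 : 0 < n%:R :> R by rewrite ltr0n.
have mp t : measurable_fun [set: RN R] (fun w => t * psum id n w).
  by apply: measurable_funM => //; exact: measurable_psum.
split=> [Q P0Q|].
  rewrite leNgt; apply/negP => big.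
  have [P' iidP'] := iid_product_probs Q.
  have Q0 : [set Q] `<=` P0 by move=> _ ->.
  have := concn P' (sub_iid_probs Q0 iidP').
  have : fine (P' [set w | n%:R * (- (c + eps) + eps / 4) <=
      - s * psum id n w]) <= 4^-1.
    apply: (utn [set Q]) => //; first by rewrite normrN.
      by rewrite normrN (le_trans (ler_normD _ _))// lerD2l ger0_norm// ltW.
    by move=> _ ->; rewrite mulNr; lra.
  set A := [set w | _]; set B := [set w | _] => A4 B4.
  have mA : measurable A by exact: measurable_ge.
  have mB : measurable B by exact: measurable_ge.
  have : 1 <= fine (P' A) + fine (P' B).
    rewrite -(Rintegral_prob_cst P' 1) -!Rintegral_prob_indic// -bmfun_intD;
      [|exact: bmfun_indic..].
    apply: bmfun_le => //; first by apply: bmfunD; exact: bmfun_indic.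
    move=> w; rewrite !indicE; have [Aw|nA] := pselect (A w).
      by rewrite (mem_set Aw) lerDl.
    have Bw : B w.
      move: nA; rewrite /A /B /= => /negP; rewrite -ltNge mulNr => h.
      have : n%:R * (- (c + eps) + eps / 4) <= n%:R * (- (c + eps / 4)).
        by rewrite ler_wpM2l//; lra.
      have : n%:R * (- (c + eps / 4)) <= n%:R * (- (c + eps / 4)) by [].
      by rewrite mulrN; lra.
    by rewrite (mem_set Bw) lerDr.
  lra.
apply: contrapT => noQ.
have small Q : P0 Q -> s * \int[Q]_y clip n%:R y <= c - eps.
  move=> P0Q; rewrite leNgt; apply/negP => h.
  by apply: noQ; exists Q => //; exact: ltW.
have : fine (P [set w | n%:R * (c - eps + eps / 4) <= s * psum id n w]) <= 4^-1.
  apply: (utn P0) => //.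
  by rewrite (le_trans (ler_normB _ _))// lerD2l ger0_norm// ltW.
set A := [set w | _] => A4.
have mA : measurable A by exact: measurable_ge.
have : \int[P]_w ramp s (c - eps / 2) (eps / 2) (psum id n w / n%:R) <=
    fine (P A).
  rewrite -Rintegral_prob_indic//; apply: bmfun_le.
  - exact/bmfun_mean/Cb_bmfun/Cb_ramp.
  - exact: bmfun_indic.
  move=> w; rewrite indicE; have [Aw|nA] := pselect (A w).
    rewrite (mem_set Aw).
    by have /andP[] := ramp01 s (c - eps / 2) (eps / 2) (psum id n w / n%:R).
  rewrite memNset// ramp0//; first by lra.
  move: nA; rewrite /A /= => /negP; rewrite -ltNge mulrA ler_pdivrMr// => h.
  have : n%:R * (c - eps + eps / 4) <= n%:R * (c - eps / 2).
    by rewrite ler_wpM2l//; lra.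
  by rewrite (mulrC _ n%:R); lra.
lra.
Qed.

End necessity.

Theorem theorem3p2 (R : realType) (P0 : set (probability R R)) (mulo muhi : R)
    (P0_nonempty : P0 !=set0) (P0_convex : convex_probs P0)
    (P0_compact : weakly_compact P0) (mulo_le_muhi : mulo <= muhi) :
  (forall phi : R -> R, Cb phi ->
     exists2 m : R, is_maximum (phi @` `[mulo, muhi]) m &
       sublin_exp (iid_probs P0)
         (fun w => phi ((\sum_(i < n) canon_rv i w) / n%:R)) @[n --> \oo]
         --> m%:E)
  <->
  [/\ (n%:R%:E * upper_cap (iid_probs P0) [set w | (n%:R <= `|canon_rv 0 w|)%R])%E
        @[n --> \oo] --> 0%:E,
      sublin_exp (iid_probs P0)
        (fun w => Num.min (Num.max (- n%:R) (canon_rv 0 w)) n%:R) @[n --> \oo]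
        --> muhi%:E &
      (- sublin_exp (iid_probs P0)
           (fun w => Num.min (Num.max (- n%:R) (- canon_rv 0 w)) n%:R)%R)%E
        @[n --> \oo] --> mulo%:E].
Proof.
have hiI : mulo <= muhi <= muhi by rewrite mulo_le_muhi lexx.
have loI : mulo <= mulo <= muhi by rewrite mulo_le_muhi lexx.
split=> [limit|[/(tail_cvgP P0_nonempty) tails /(clip_cvgP _ P0_nonempty) up
    /(clipN_cvgP P0_nonempty) low] phi Cphi].
  have {}limit phi : Cb phi ->
    exists2 m : R, is_maximum (phi @` `[mulo, muhi]) m &
    sup_tends (iid_probs P0) (fun n P => \int[P]_w phi (psum id n w / n%:R)) m.
    move=> Cphi; have [m mmax lim] := limit phi Cphi; exists m => //.
    exact/(mean_cvgP P0_nonempty).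
  split.
  - exact/(tail_cvgP P0_nonempty)/(tails_of_limit limit).
  - apply/(clip_cvgP _ P0_nonempty).
    have s1 : `|1 : R| <= 1 by rewrite normr1.
    have hi x : mulo <= x <= muhi -> 1 * x <= muhi by rewrite mul1r => /andP[].
    move=> eps /(clip_of_limit limit s1 hi hiI (mul1r _))[N NP].
    exists N => n /NP[ub [Q P0Q lb]].
    split=> [Q' /ub|]; first by rewrite mul1r.
    by exists Q => //; rewrite -[leRHS]mul1r.
  - apply/(clipN_cvgP P0_nonempty).
    have s1 : `|-1 : R| <= 1 by rewrite normrN1.
    have lo x : mulo <= x <= muhi -> -1 * x <= - mulo.
      by rewrite mulN1r lerN2 => /andP[].
    exact: (clip_of_limit limit s1 lo loI (mulN1r _)).
have [c cI cmax] : exists2 c, c \in `[mulo, muhi] &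
    forall t, t \in `[mulo, muhi] -> phi t <= phi c.
  apply: EVT_max => //; have [cphi _] := Cphi.
  by apply: continuous_subspaceT => x; exact: cphi.
have mmax : is_maximum (phi @` `[mulo, muhi]) (phi c).
  by split; [exists c|move=> _ [x xI <-]; exact: cmax].
exists (phi c) => //; apply/(mean_cvgP P0_nonempty) => //.
exact: (mean_limit P0_convex mulo_le_muhi tails up low Cphi mmax).
Qed.
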